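(* Let $R$ be a commutative Noetherian ring (not necessarily local) satisfying Serre's condition $(S_2)$, and let $I$ be an integrally closed ideal of $R$ of positive height. Then $I$ is locally free of rank one (so represents a class in $\mathrm{Pic}\,R$) if and only if $I\otimes_R I^{\ast}$ is reflexive. Moreover, if either of these equivalent conditions holds, then a primary decomposition of $I$ is of the form $$I=\bigcap_{\mathfrak{p}\in \mathrm{Ass}_R(R/I)}\mathfrak{p}^{(n(\mathfrak{p}))},$$ where, for each $\mathfrak{p}\in\mathrm{Ass}_R(R/I)$, $n(\mathfrak{p})$ is a positive integer and $\mathfrak{p}^{(n(\mathfrak{p}))}$ is the $n(\mathfrak{p})$-th symbolic power of $\mathfrak{p}$.
   Context: For an $R$-module $M$, $M^{\ast}=\mathrm{Hom}_R(M,R)$, and $M$ is reflexive if the natural map $M\to M^{\ast\ast}$ is an isomorphism. $R$ satisfies Serre's condition $(S_n)$ if $\mathrm{depth}\,R_{\mathfrak{p}}\ge\min\{n,\dim R_{\mathfrak{p}}\}$ for all $\mathfrak{p}\in\mathrm{Spec}(R)$. $\mathrm{Pic}\,R$ consists of the isomorphism classes of finitely generated projective $R$-modules $M$ such that $M_{\mathfrak{p}}\cong R_{\mathfrak{p}}$ for all $\mathfrak{p}\in\mathrm{Spec}(R)$; thus $I$ being locally free of rank one means $I_{\mathfrak{p}}\cong R_{\mathfrak{p}}$ for all $\mathfrak{p}\in\mathrm{Spec}(R)$. The symbolic power $\mathfrak{p}^{(n)}$ is the preimage of $\mathfrak{p}^nR_{\mathfrak{p}}$ under $R\to R_{\mathfrak{p}}$.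 *)

(* Defs.v *)
From HB Require Import structures.
From mathcomp Require Import all_boot all_order all_algebra.
From mathcomp Require Import ring.
From mathcomp Require Import boolp classical_sets cardinality constructive_ereal.

Set Implicit Arguments.
Unset Strict Implicit.
Unset Printing Implicit Defensive.

Import Order.TTheory GRing.Theory Num.Theory.

Local Open Scope quotient_scope.
Local Open Scope classical_set_scope.
Local Open Scope ring_scope.

(* The unit ideal is allowed, and so is the zero ring. *)
Definition is_ideal (R : comPzRingType) (I : set R) : Prop :=
  [/\ I 0, (forall x y, I x -> I y -> I (x + y))
    & (forall a x, I x -> I (a * x))].

Definition is_prime_ideal (R : comPzRingType) (p : set R) : Prop :=
  [/\ is_ideal p, ~ p 1 & (forall x y, p (x * y) -> p x \/ p y)].

Record ideal (R : comPzRingType) :=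
  Ideal { ideal_set :> set R; idealP : is_ideal ideal_set }.

Record Spec (R : comPzRingType) :=
  MkSpec { spec_set :> set R; specP : is_prime_ideal spec_set }.

Definition ideal_gen (R : comPzRingType) (A : set R) : set R :=
  smallest (@is_ideal R) A.

Fixpoint ideal_pow (R : comPzRingType) (I : set R) (n : nat) : set R :=
  if n is m.+1 then
    ideal_gen [set z | exists x y, [/\ I x, ideal_pow I m y & z = x * y]]
  else setT.

Definition noetherian (R : comPzRingType) : Prop :=
  forall I : set R, is_ideal I -> exists s : seq R, I = ideal_gen [set` s].

Definition integral_closure (R : comPzRingType) (I : set R) : set R :=
  [set r | exists (n : nat) (a : nat -> R),
     [/\ (0 < n)%N,
         (forall i, (0 < i <= n)%N -> ideal_pow I i (a i))
       & r ^+ n + \sum_(1 <= i < n.+1) a i * r ^+ (n - i) = 0]].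

Definition integrally_closed (R : comPzRingType) (I : set R) : Prop :=
  integral_closure I = I.

(* On sets of naturals these bounds always exist, so that the [xget] default
   in [supremum] is never reached. *)
Definition sup_nat (A : set nat) : \bar int :=
  supremum -oo%E [set (Posz n)%:E%E | n in A].

Definition prime_chain (R : comPzRingType) (c : nat -> Spec R) (n : nat) :=
  forall i, (i < n)%N -> c i `<` c i.+1.

Definition krull_dim (R : comPzRingType) : \bar int :=
  sup_nat [set n | exists c : nat -> Spec R, prime_chain c n].

Definition prime_height (R : comPzRingType) (p : Spec R) : \bar int :=
  sup_nat [set n | exists2 c : nat -> Spec R, prime_chain c n & c n = p].

Definition ideal_height (R : comPzRingType) (I : set R) : \bar int :=
  infimum +oo%E [set prime_height p | p in [set p : Spec R | I `<=` p]].

Definition regular_seq (R : comPzRingType) (s : seq R) : Prop :=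
  ~ ideal_gen [set` s] 1 /\
  forall i, (i < size s)%N -> forall a : R,
    ideal_gen [set` take i s] (s`_i * a) -> ideal_gen [set` take i s] a.

(* [depth m] is the depth of the ring itself when it is local with maximal
   ideal [m]. *)
Definition depth (R : comPzRingType) (m : set R) : \bar int :=
  sup_nat [set n | exists s : seq R,
    [/\ size s = n, (forall x, x \in s -> m x) & regular_seq s]].

Section Localization.
Variables (R : comPzRingType) (p : Spec R).

Definition denom : Type := {s : R | `[< ~ spec_set p s >]}.
HB.instance Definition _ := Choice.on denom.

Definition den (s : denom) : R := val s.

Lemma denomP (s : denom) : ~ spec_set p (den s).
Proof. exact/asboolP/(valP s). Qed.

Fact denom1_subproof : `[< ~ spec_set p 1 >].
Proof. by apply/asboolP; case: (specP p). Qed.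

Fact denomM_subproof (s t : denom) : `[< ~ spec_set p (den s * den t) >].
Proof.
by apply/asboolP; case: (specP p) => _ _ pM /pM[]; exact: denomP.
Qed.

Definition denom1 : denom := exist _ 1 denom1_subproof.
Definition denomM (s t : denom) : denom := 
  exist _ (den s * den t) (denomM_subproof s t).

Lemma den1 : den denom1 = 1. Proof. by []. Qed.
Lemma denM s t : den (denomM s t) = den s * den t. Proof. by []. Qed.
Let denE := (den1, denM).

Section Carrier.
Variable M : lmodType R.

Definition loc_eq (x y : M * denom) : bool :=
  `[< exists t : denom,
      (den t * den y.2) *: x.1 = (den t * den x.2) *: y.1 >].

Fact loc_eq_refl : reflexive loc_eq.
Proof. by move=> x; apply/asboolP; exists denom1. Qed.

Fact loc_eq_sym : symmetric loc_eq.
Proof. by move=> x y; apply/asboolP/asboolP => -[t tE]; exists t. Qed.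

Fact loc_eq_trans : transitive loc_eq.
Proof.
move=> y x z /asboolP[t tE] /asboolP[u uE]; apply/asboolP.
exists (denomM (denomM t u) y.2); rewrite !denE.
transitivity ((den u * den z.2) *: ((den t * den y.2) *: x.1)).
  by rewrite scalerA; congr (_ *: _); ring.
transitivity ((den t * den x.2) *: ((den u * den z.2) *: y.1)).
  by rewrite tE !scalerA; congr (_ *: _); ring.
by rewrite uE scalerA; congr (_ *: _); ring.
Qed.

Canonical loc_eq_equiv := EquivRel loc_eq loc_eq_refl loc_eq_sym loc_eq_trans.

Definition locmod : Type := {eq_quot loc_eq}.
HB.instance Definition _ : EqQuotient _ loc_eq locmod := EqQuotient.on locmod.
HB.instance Definition _ := Choice.on locmod.

Definition frac (m : M) (s : denom) : locmod := \pi_locmod (m, s).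

Lemma fracP m s n t :
  frac m s = frac n t <->
  exists u : denom, (den u * den t) *: m = (den u * den s) *: n.
Proof.
split=> [/eqmodP/asboolP //|H]; by apply/eqmodP/asboolP.
Qed.

Lemma frac_ind (P : locmod -> Prop) :
  (forall m s, P (frac m s)) -> forall x, P x.
Proof. by move=> H; elim/quotW=> -[m s]; exact: H. Qed.

Definition loc_add (x y : locmod) : locmod :=
  let: (m, s) := repr x in let: (n, t) := repr y in
  frac (den t *: m + den s *: n) (denomM s t).

Definition loc_opp (x : locmod) : locmod :=
  let: (m, s) := repr x in frac (- m) s.

Fact repr_frac m s : exists n t, repr (frac m s) = (n, t) /\
  exists u : denom, (den u * den t) *: m = (den u * den s) *: n.
Proof.
case E: (repr _) => [n t]; exists n, t; split=> //.
by apply/fracP; rewrite [RHS]/frac -E reprK.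
Qed.

Lemma loc_addE m s n t : loc_add (frac m s) (frac n t) =
  frac (den t *: m + den s *: n) (denomM s t).
Proof.
rewrite /loc_add; have [m' [s' [-> [u uE]]]] := repr_frac m s.
have [n' [t' [-> [v vE]]]] := repr_frac n t.
apply/fracP; exists (denomM u v); rewrite !denE !scalerDr !scalerA; congr (_ + _).
  transitivity ((den v * den t * den t') *: ((den u * den s) *: m')).
    by rewrite !scalerA; congr (_ *: _); ring.
  by rewrite -uE !scalerA; congr (_ *: _); ring.
transitivity ((den u * den s * den s') *: ((den v * den t) *: n')).
  by rewrite !scalerA; congr (_ *: _); ring.
by rewrite -vE !scalerA; congr (_ *: _); ring.
Qed.

Lemma loc_oppE m s : loc_opp (frac m s) = frac (- m) s.
Proof.
rewrite /loc_opp; have [m' [s' [-> [u uE]]]] := repr_frac m s.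
by apply/fracP; exists u; rewrite !scalerN uE.
Qed.

Fact loc_addA : associative loc_add.
Proof.
elim/frac_ind=> m s; elim/frac_ind=> n t; elim/frac_ind=> q u.
rewrite !loc_addE; apply/fracP; exists denom1; rewrite !denE.
by rewrite !(scalerDr, scalerA) addrA; congr (_ *: _ + _ *: _ + _ *: _); ring.
Qed.

Fact loc_addC : commutative loc_add.
Proof.
elim/frac_ind=> m s; elim/frac_ind=> n t.
rewrite !loc_addE; apply/fracP; exists denom1; rewrite !denE.
by rewrite addrC mulrC [den s * _]mulrC mulrC.
Qed.

Fact loc_add0 : left_id (frac 0 denom1) loc_add.
Proof.
elim/frac_ind=> m s; rewrite loc_addE; apply/fracP; exists denom1; rewrite !denE.
by rewrite scaler0 add0r scale1r !mul1r.
Qed.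

Fact loc_addN : left_inverse (frac 0 denom1) loc_opp loc_add.
Proof.
elim/frac_ind=> m s; rewrite loc_oppE loc_addE; apply/fracP.
by exists denom1; rewrite !denE scalerN addNr !scaler0.
Qed.

HB.instance Definition _ :=
  GRing.isZmodule.Build locmod loc_addA loc_addC loc_add0 loc_addN.

Lemma fracD m s n t :
  frac m s + frac n t = frac (den t *: m + den s *: n) (denomM s t).
Proof. exact: loc_addE. Qed.

End Carrier.

Definition locring : Type := locmod R^o.
HB.instance Definition _ := GRing.Zmodule.on locring.

Section Scale.
Variable M : lmodType R.

Definition loc_scale (a : locring) (x : locmod M) : locmod M :=
  let: (r, s) := repr (a : locmod R^o) in let: (m, t) := repr x in
  frac (r *: m) (denomM s t).

Lemma loc_scaleE (r : R^o) s (m : M) t :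
  loc_scale (frac r s) (frac m t) = frac (r *: m) (denomM s t).
Proof.
rewrite /loc_scale; have [r' [s' [-> [u uE]]]] := repr_frac r s.
have [m' [t' [-> [v vE]]]] := repr_frac m t.
have {}uE : den u * den s' * r = den u * den s * r' by [].
apply/fracP; exists (denomM u v); rewrite !denE !scalerA.
transitivity ((den u * den s * r') *: ((den v * den t) *: m')).
  by rewrite !scalerA; congr (_ *: _); ring.
by rewrite -vE -uE !scalerA; congr (_ *: _); ring.
Qed.
End Scale.

Definition loc_one : locring := frac (1 : R^o) denom1.
Definition loc_mul : locring -> locring -> locring := @loc_scale R^o.

Section ScaleTheory.
Variable M : lmodType R.

Fact loc_scaleA a b (x : locmod M) :
  loc_scale a (loc_scale b x) = loc_scale (loc_mul a b) x.
Proof.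
elim/frac_ind: a => a s; elim/frac_ind: b => b t; elim/frac_ind: x => m u.
rewrite /loc_mul !loc_scaleE scalerA; apply/fracP; exists denom1; rewrite !denE.
by rewrite !mulrA.
Qed.

Fact loc_scale1 : left_id loc_one (@loc_scale M).
Proof.
elim/frac_ind=> m s; rewrite loc_scaleE scale1r; apply/fracP.
by exists denom1; rewrite !denE !mul1r.
Qed.

Fact loc_scaleDr : right_distributive (@loc_scale M) +%R.
Proof.
elim/frac_ind=> a s; elim/frac_ind=> m t; elim/frac_ind=> n u.
rewrite fracD !loc_scaleE fracD; apply/fracP; exists denom1; rewrite !denE.
by rewrite !(scalerDr, scalerA); congr (_ *: _ + _ *: _); ring.
Qed.

Fact loc_scaleDl (x : locmod M) : {morph (fun a => loc_scale a x) : a b / a + b}.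
Proof.
elim/frac_ind: x => m t; elim/frac_ind=> a s; elim/frac_ind=> b u.
rewrite [in LHS]fracD !loc_scaleE fracD; apply/fracP; exists denom1; rewrite !denE.
rewrite !(scalerDr, scalerA) -scalerDl; congr (_ *: _).
rewrite -![_ *: (_ : R^o)]/(_ * (_ : R)); ring.
Qed.
End ScaleTheory.

Fact loc_mulC : commutative loc_mul.
Proof.
elim/frac_ind=> a s; elim/frac_ind=> b t; rewrite /loc_mul !loc_scaleE.
apply/fracP; exists denom1; rewrite !denE.
rewrite -![_ *: (_ : R^o)]/(_ * (_ : R)); ring.
Qed.

Fact loc_mulA : associative loc_mul.
Proof. by move=> a b c; rewrite /loc_mul loc_scaleA. Qed.

Fact loc_mul1 : left_id loc_one loc_mul.
Proof. exact: loc_scale1. Qed.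

Fact loc_mulDl : left_distributive loc_mul +%R.
Proof. by move=> a b c; exact: loc_scaleDl. Qed.

HB.instance Definition _ := GRing.Zmodule_isComPzRing.Build locring
  loc_mulA loc_mulC loc_mul1 loc_mulDl.

HB.instance Definition _ (M : lmodType R) :=
  GRing.Zmodule_isLmodule.Build locring (locmod M)
    (@loc_scaleA M) (@loc_scale1 M) (@loc_scaleDr M) (@loc_scaleDl M).

Definition to_locring (r : R) : locring := frac (r : R^o) denom1.

End Localization.

Definition loc_extension (R : comPzRingType) (p : Spec R) (J : set R) :
  set (locring p) := ideal_gen [set to_locring p r | r in J].
Arguments loc_extension {R} p J.

Definition symbolic_power (R : comPzRingType) (p : Spec R) (n : nat) : set R :=
  to_locring p @^-1` loc_extension p (ideal_pow p n).

Definition serre_condition (R : comPzRingType) (n : nat) : Prop :=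
  forall p : Spec R,
    (Order.min (Posz n)%:E (krull_dim (locring p)) <=
     depth (loc_extension p p))%E.

Section IdealModule.
Variables (R : comPzRingType) (I : ideal R).

Definition ideal_pred : {pred R^o} := fun x => `[< ideal_set I x >].

Fact ideal_pred_submod : submod_closed ideal_pred.
Proof.
have [I0 ID IM] := idealP I.
split=> [|a x y /asboolP Ix /asboolP Iy]; apply/asboolP => //.
by apply: ID => //; exact: IM.
Qed.

HB.instance Definition _ :=
  GRing.isSubmodClosed.Build R R^o ideal_pred ideal_pred_submod.

Record ideal_mod := IdealMod {
  ideal_val : R^o; ideal_valP : ideal_val \in ideal_pred }.

HB.instance Definition _ := [isSub for ideal_val].
HB.instance Definition _ := [Choice of ideal_mod by <:].
HB.instance Definition _ := [SubChoice_isSubLmodule of ideal_mod by <:].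

Definition quot_eq (x y : R^o) : bool := x - y \in ideal_pred.

Fact quot_eq_refl : reflexive quot_eq.
Proof. by move=> x; rewrite /quot_eq subrr rpred0. Qed.

Fact quot_eq_sym : symmetric quot_eq.
Proof. by move=> x y; rewrite /quot_eq -opprB rpredN. Qed.

Fact quot_eq_trans : transitive quot_eq.
Proof.
move=> y x z xy yz; rewrite /quot_eq -[x](subrK y) -addrA; exact: rpredD.
Qed.

Canonical quot_eq_equiv :=
  EquivRel quot_eq quot_eq_refl quot_eq_sym quot_eq_trans.

Definition quot_mod : Type := {eq_quot quot_eq}.
HB.instance Definition _ : EqQuotient _ quot_eq quot_mod :=
  EqQuotient.on quot_mod.
HB.instance Definition _ := Choice.on quot_mod.

Definition quot_proj (x : R^o) : quot_mod := \pi_quot_mod x.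

Lemma quot_projP x y : quot_proj x = quot_proj y <-> x - y \in ideal_pred.
Proof. by split=> [/eqmodP //|H]; apply/eqmodP. Qed.

Lemma quot_ind (P : quot_mod -> Prop) :
  (forall x, P (quot_proj x)) -> forall x, P x.
Proof. exact: quotW. Qed.

Fact repr_quot x : repr (quot_proj x) - x \in ideal_pred.
Proof.
by apply: (proj1 (quot_projP _ _)); rewrite [LHS]/quot_proj reprK.
Qed.

Definition quot_add (x y : quot_mod) := quot_proj (repr x + repr y).
Definition quot_opp (x : quot_mod) := quot_proj (- repr x).
Definition quot_scale (a : R) (x : quot_mod) := quot_proj (a *: repr x).

Lemma quot_addE x y : quot_add (quot_proj x) (quot_proj y) = quot_proj (x + y).
Proof.
apply: (proj2 (quot_projP _ _)); rewrite opprD addrACA.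
by apply: rpredD; exact: repr_quot.
Qed.

Lemma quot_oppE x : quot_opp (quot_proj x) = quot_proj (- x).
Proof.
by apply: (proj2 (quot_projP _ _)); rewrite -opprD rpredN; exact: repr_quot.
Qed.

Lemma quot_scaleE a x : quot_scale a (quot_proj x) = quot_proj (a *: x).
Proof.
by apply: (proj2 (quot_projP _ _)); rewrite -scalerBr; apply: rpredZ; exact: repr_quot.
Qed.

Fact quot_addA : associative quot_add.
Proof.
by elim/quot_ind=> x; elim/quot_ind=> y; elim/quot_ind=> z; rewrite !quot_addE addrA.
Qed.

Fact quot_addC : commutative quot_add.
Proof. by elim/quot_ind=> x; elim/quot_ind=> y; rewrite !quot_addE addrC. Qed.

Fact quot_add0 : left_id (quot_proj 0) quot_add.
Proof. by elim/quot_ind=> x; rewrite quot_addE add0r. Qed.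

Fact quot_addN : left_inverse (quot_proj 0) quot_opp quot_add.
Proof. by elim/quot_ind=> x; rewrite quot_oppE quot_addE addNr. Qed.

HB.instance Definition _ :=
  GRing.isZmodule.Build quot_mod quot_addA quot_addC quot_add0 quot_addN.

Lemma quot_projD x y : quot_proj x + quot_proj y = quot_proj (x + y).
Proof. exact: quot_addE. Qed.

Fact quot_scaleA a b x : quot_scale a (quot_scale b x) = quot_scale (a * b) x.
Proof. by elim/quot_ind: x => x; rewrite !quot_scaleE scalerA. Qed.

Fact quot_scale1 : left_id 1 quot_scale.
Proof. by elim/quot_ind=> x; rewrite quot_scaleE scale1r. Qed.

Fact quot_scaleDr : right_distributive quot_scale +%R.
Proof.
move=> a; elim/quot_ind=> x; elim/quot_ind=> y.
by rewrite quot_projD !quot_scaleE quot_projD scalerDr.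
Qed.

Fact quot_scaleDl x : {morph quot_scale^~ x : a b / a + b}.
Proof.
elim/quot_ind: x => x a b /=.
by rewrite !quot_scaleE quot_projD scalerDl.
Qed.

HB.instance Definition _ := GRing.Zmodule_isLmodule.Build R quot_mod
  quot_scaleA quot_scale1 quot_scaleDr quot_scaleDl.

End IdealModule.

Definition Ass (R : comPzRingType) (M : lmodType R) : set (Spec R) :=
  [set p | exists m : M, forall r, spec_set p r <-> r *: m = 0].

Definition radical (R : comPzRingType) (I : set R) : set R :=
  [set r | exists n : nat, I (r ^+ n)].

Definition is_primary (R : comPzRingType) (Q : set R) : Prop :=
  [/\ is_ideal Q, ~ Q 1
    & (forall x y, Q (x * y) -> Q x \/ radical Q y)].

Definition primary_decomposition (R : comPzRingType) (I : set R)
    (D : set (Spec R)) (Q : Spec R -> set R) : Prop :=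
  [/\ finite_set D,
      (forall p, D p -> is_primary (Q p) /\ radical (Q p) = p)
    & I = \bigcap_(p in D) Q p].

Section Dual.
Variables (R : comPzRingType) (M : lmodType R).

Definition dual : Type := {linear M -> R^o}.
HB.instance Definition _ := gen_eqMixin dual.
HB.instance Definition _ := gen_choiceMixin dual.

Definition dual_fun (f : dual) : M -> R^o := f.

Lemma dualP (f g : dual) : dual_fun f =1 dual_fun g -> f = g.
Proof.
move=> /funext; case: f => f cf; case: g => g cg; rewrite /dual_fun/= => E.
subst g; congr GRing.Linear.Pack.
case: cf => -[a] [b]; case: cg => -[c] [d]; congr (GRing.Linear.Class _ _).
  by congr (GRing.isNmodMorphism.Axioms_ _ _); exact: Prop_irrelevance.
by congr (GRing.isScalable.Axioms_ _ _); exact: Prop_irrelevance.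
Qed.

Implicit Types f g h : dual.

Definition dual_zero : dual := (\0 : {linear M -> R^o}).
Definition dual_add f g : dual :=
  (f : {linear M -> R^o}) \+ (g : {linear M -> R^o}).
Definition dual_opp f : dual := \- (f : {linear M -> R^o}).
Definition dual_scale (a : R) f : dual := a \*: (f : {linear M -> R^o}).

Fact dual_addA : associative dual_add.
Proof. by move=> f g h; apply: dualP => x; exact: addrA. Qed.

Fact dual_addC : commutative dual_add.
Proof. by move=> f g; apply: dualP => x; exact: addrC. Qed.

Fact dual_add0 : left_id dual_zero dual_add.
Proof. by move=> f; apply: dualP => x; exact: add0r. Qed.

Fact dual_addN : left_inverse dual_zero dual_opp dual_add.
Proof. by move=> f; apply: dualP => x; exact: addNr. Qed.

HB.instance Definition _ :=
  GRing.isZmodule.Build dual dual_addA dual_addC dual_add0 dual_addN.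

Fact dual_scaleA a b f : dual_scale a (dual_scale b f) = dual_scale (a * b) f.
Proof. by apply: dualP => x; exact: scalerA. Qed.

Fact dual_scale1 : left_id 1 dual_scale.
Proof. by move=> f; apply: dualP => x; exact: scale1r. Qed.

Fact dual_scaleDr : right_distributive dual_scale +%R.
Proof. by move=> a f g; apply: dualP => x; exact: scalerDr. Qed.

Fact dual_scaleDl f : {morph dual_scale^~ f : a b / a + b}.
Proof. by move=> a b; apply: dualP => x; exact: scalerDl. Qed.

HB.instance Definition _ := GRing.Zmodule_isLmodule.Build R dual
  dual_scaleA dual_scale1 dual_scaleDr dual_scaleDl.

Definition dual_eval (x : M) : dual -> R^o := fun f => dual_fun f x.

Fact dual_eval_linear x : linear (dual_eval x).
Proof. by []. Qed.

HB.instance Definition _ x :=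
  GRing.isLinear.Build R dual R^o *:%R (dual_eval x) (dual_eval_linear x).

End Dual.

Definition bidual_map (R : comPzRingType) (M : lmodType R) (x : M) :
  dual (dual M) := (dual_eval x : {linear dual M -> R^o}).

Definition is_reflexive (R : comPzRingType) (M : lmodType R) : Prop :=
  bijective (@bidual_map R M).

(* An element of the tensor product is a class of formal sums of pure tensors;
   the sequence [:: (x_1, y_1); ...; (x_k, y_k)] stands for
   x_1 (x) y_1 + ... + x_k (x) y_k. *)
Section Tensor.
Variables (R : comPzRingType) (M N : lmodType R).

Inductive tensor_rel : seq (M * N) -> seq (M * N) -> Prop :=
| TensorRefl s : tensor_rel s s
| TensorSym s t : tensor_rel s t -> tensor_rel t s
| TensorTrans t s u : tensor_rel s t -> tensor_rel t u -> tensor_rel s u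
| TensorCat s s' t t' :
    tensor_rel s s' -> tensor_rel t t' -> tensor_rel (s ++ t) (s' ++ t')
| TensorCatC s t : tensor_rel (s ++ t) (t ++ s)
| TensorDl x x' y : tensor_rel [:: (x + x', y)] [:: (x, y); (x', y)]
| TensorDr x y y' : tensor_rel [:: (x, y + y')] [:: (x, y); (x, y')]
| TensorZ a x y : tensor_rel [:: (a *: x, y)] [:: (x, a *: y)]
| Tensor0 y : tensor_rel [:: (0, y)] [::].

Definition tensor_eq (s t : seq (M * N)) : bool := `[< tensor_rel s t >].

Fact tensor_eq_refl : reflexive tensor_eq.
Proof. by move=> s; apply/asboolP; exact: TensorRefl. Qed.

Fact tensor_eq_sym : symmetric tensor_eq.
Proof. by move=> s t; apply/asboolP/asboolP; exact: TensorSym. Qed.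

Fact tensor_eq_trans : transitive tensor_eq.
Proof.
by move=> t s u /asboolP st /asboolP tu; apply/asboolP; exact: TensorTrans tu.
Qed.

Canonical tensor_eq_equiv :=
  EquivRel tensor_eq tensor_eq_refl tensor_eq_sym tensor_eq_trans.

Definition tensor : Type := {eq_quot tensor_eq}.
HB.instance Definition _ : EqQuotient _ tensor_eq tensor :=
  EqQuotient.on tensor.
HB.instance Definition _ := Choice.on tensor.

Definition tensor_sum (s : seq (M * N)) : tensor := \pi_tensor s.
Definition pure_tensor (x : M) (y : N) : tensor := tensor_sum [:: (x, y)].

Lemma tensor_sumP s t : tensor_sum s = tensor_sum t <-> tensor_rel s t.
Proof. by split=> [/eqmodP/asboolP //|H]; apply/eqmodP/asboolP. Qed.

Lemma tensor_ind (P : tensor -> Prop) :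
  (forall s, P (tensor_sum s)) -> forall u, P u.
Proof. exact: quotW. Qed.

Fact repr_tensor s : tensor_rel (repr (tensor_sum s)) s.
Proof. by apply/tensor_sumP; rewrite [LHS]/tensor_sum reprK. Qed.

Definition scale_pairs (a : R) (s : seq (M * N)) : seq (M * N) :=
  [seq (a *: xy.1, xy.2) | xy <- s].

Fact scale_pairs_rel a s t :
  tensor_rel s t -> tensor_rel (scale_pairs a s) (scale_pairs a t).
Proof.
elim=> {s t} [s|s t _|t s u _ + _|s s' t t' _ + _|s t|x x' y|x y y'|b x y|y].
- exact: TensorRefl.
- exact: TensorSym.
- exact: TensorTrans.
- by rewrite /scale_pairs !map_cat; exact: TensorCat.
- by rewrite /scale_pairs !map_cat; exact: TensorCatC.
- by rewrite /= scalerDr; exact: TensorDl.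
- exact: TensorDr.
- by rewrite /= scalerA mulrC -scalerA; exact: TensorZ.
- by rewrite /= scaler0; exact: Tensor0.
Qed.

Definition tensor_add (u v : tensor) := tensor_sum (repr u ++ repr v).
Definition tensor_scale (a : R) (u : tensor) :=
  tensor_sum (scale_pairs a (repr u)).
Definition tensor_opp (u : tensor) := tensor_scale (-1) u.

Lemma tensor_addE s t :
  tensor_add (tensor_sum s) (tensor_sum t) = tensor_sum (s ++ t).
Proof. by apply/tensor_sumP; apply: TensorCat; exact: repr_tensor. Qed.

Lemma tensor_scaleE a s :
  tensor_scale a (tensor_sum s) = tensor_sum (scale_pairs a s).
Proof. by apply/tensor_sumP; apply: scale_pairs_rel; exact: repr_tensor. Qed.

Fact tensor_addA : associative tensor_add.
Proof.
elim/tensor_ind=> s; elim/tensor_ind=> t; elim/tensor_ind=> u.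
by rewrite !tensor_addE catA.
Qed.

Fact tensor_addC : commutative tensor_add.
Proof.
elim/tensor_ind=> s; elim/tensor_ind=> t; rewrite !tensor_addE.
by apply/tensor_sumP; exact: TensorCatC.
Qed.

Fact tensor_add0 : left_id (tensor_sum [::]) tensor_add.
Proof. by elim/tensor_ind=> s; rewrite tensor_addE. Qed.

Fact tensor_scaleDl u : {morph tensor_scale^~ u : a b / a + b >-> tensor_add a b}.
Proof.
elim/tensor_ind: u => s a b; rewrite !tensor_scaleE tensor_addE.
apply/tensor_sumP; elim: s => [|[x y] s IHs] /=; first exact: TensorRefl.
rewrite -cat1s -[_ :: _ ++ _]cat1s scalerDl.
apply: TensorTrans (TensorCat (TensorDl _ _ _) IHs) _.
rewrite -[_ :: scale_pairs b s]cat1s -[[:: _; _]]cat1s -!catA.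
apply: TensorCat; first exact: TensorRefl.
rewrite !catA; apply: TensorCat; last exact: TensorRefl.
exact: TensorCatC.
Qed.

Fact tensor_scale0 u : tensor_scale 0 u = tensor_sum [::].
Proof.
elim/tensor_ind: u => s; rewrite tensor_scaleE; apply/tensor_sumP.
elim: s => [|[x y] s IHs] /=; first exact: TensorRefl.
by rewrite scale0r -cat1s -[[::]]cat0s; exact: TensorCat (Tensor0 _) IHs.
Qed.

Fact tensor_scale1 : left_id 1 tensor_scale.
Proof.
elim/tensor_ind=> s; rewrite tensor_scaleE; congr tensor_sum.
by elim: s => //= -[x y] s ->; rewrite scale1r.
Qed.

Fact tensor_addN : left_inverse (tensor_sum [::]) tensor_opp tensor_add.
Proof.
move=> u; rewrite -{2}[u]tensor_scale1 -tensor_scaleDl addNr.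
exact: tensor_scale0.
Qed.

HB.instance Definition _ := GRing.isZmodule.Build tensor
  tensor_addA tensor_addC tensor_add0 tensor_addN.

Lemma tensor_sumD s t : tensor_sum s + tensor_sum t = tensor_sum (s ++ t).
Proof. exact: tensor_addE. Qed.

Fact tensor_scaleA a b u :
  tensor_scale a (tensor_scale b u) = tensor_scale (a * b) u.
Proof.
elim/tensor_ind: u => s; rewrite !tensor_scaleE; congr tensor_sum.
by elim: s => //= -[x y] s ->; rewrite scalerA.
Qed.

Fact tensor_scaleDr : right_distributive tensor_scale +%R.
Proof.
move=> a; elim/tensor_ind=> s; elim/tensor_ind=> t.
by rewrite tensor_sumD !tensor_scaleE tensor_sumD /scale_pairs map_cat.
Qed.

HB.instance Definition _ := GRing.Zmodule_isLmodule.Build R tensor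
  tensor_scaleA tensor_scale1 tensor_scaleDr tensor_scaleDl.

End Tensor.

Definition finitely_generated (R : comPzRingType) (M : lmodType R) : Prop :=
  exists (n : nat) (e : 'I_n -> M),
    forall x, exists a : 'I_n -> R, x = \sum_i a i *: e i.

Definition is_projective (R : comPzRingType) (M : lmodType R) : Prop :=
  forall (U V : lmodType R) (g : {linear U -> V}) (f : {linear M -> V}),
    (forall v, exists u, g u = v) ->
    exists h : {linear M -> U}, forall x, g (h x) = f x.

Definition locally_free_rank_one (R : comPzRingType) (M : lmodType R) : Prop :=
  forall p : Spec R,
    exists f : {linear locmod p M -> (locring p)^o}, bijective f.

Definition represents_Pic_class (R : comPzRingType) (M : lmodType R) : Prop :=
  [/\ finitely_generated M, is_projective M & locally_free_rank_one M].

(* Main.v *)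
(* Let J be the trace ideal of I, the image of the evaluation I (x) I^* -> R. Being
   locally free of rank one amounts to J = R.

   I contains a nonzerodivisor d, by (S_2) and positive height. If I (x) I^* is
   reflexive, it is torsion free, hence isomorphic to J, and J is divisorial: it is
   the colon of an ideal in dR. If J <> R, then J is contained in a prime
   p = (dR : b); now depth R_p <= 1, so dim R_p <= 1 by (S_2), and p is minimal over
   I, say p = (I : u). Let g_1, ..., g_n generate I^* minimally at p.
   - If n = 1, then I_p is its own bidual up to a unit, so J_p = R_p, contradicting
     J <= p.
   - If n >= 2, let Z <= p R^n be the module of relations of the g_i. For c in Z the
     tensor \sum u c_i (x) g_i makes sense and evaluates to 0, so it vanishes; hence
     u Z_p <= I Z_p, and the determinant trick shows that u is integral over I at p,
     contradicting u notin I_p.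

   If J = R and p = (I : u) is in Ass(R/I), write I_p = x R_p. By the determinant
   trick again, (u/x) p R_p is not contained in p R_p, so p R_p is generated by the
   nonzerodivisor t = x/u and I_p = t^n R_p for some n; therefore I is the
   intersection of the symbolic powers p^(n). *)
Require Import Defs.
From HB Require Import structures.
From mathcomp Require Import all_boot all_order all_algebra.
From mathcomp Require Import fingroup perm ring.
From mathcomp Require Import boolp classical_sets cardinality constructive_ereal.

Set Implicit Arguments.
Unset Strict Implicit.
Unset Printing Implicit Defensive.

Import Order.TTheory GRing.Theory Num.Theory.

Local Open Scope classical_set_scope.
Local Open Scope ring_scope.

(** * Elementary ideal theory: generated ideals, powers, colons, primes *)

Section Ideals.
Variable R : comPzRingType.
Implicit Types (K L p : set R) (a b c r s u v w x y z : R).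

Lemma ideal0 K : is_ideal K -> K 0. Proof. by case. Qed.

Lemma idealD K x y : is_ideal K -> K x -> K y -> K (x + y).
Proof. by case=> _ KD _; apply: KD. Qed.

Lemma idealMl K a x : is_ideal K -> K x -> K (a * x).
Proof. by case=> _ _; apply. Qed.

Lemma idealMr K a x : is_ideal K -> K x -> K (x * a).
Proof. by move=> hK Kx; rewrite mulrC; apply: (idealMl _ hK). Qed.

Lemma idealN K x : is_ideal K -> K x -> K (- x).
Proof. by move=> hK Kx; rewrite -mulN1r; apply: (idealMl _ hK). Qed.

Lemma idealB K x y : is_ideal K -> K x -> K y -> K (x - y).
Proof. by move=> hK Kx Ky; apply: (idealD hK) => //; apply: (idealN hK). Qed.

Lemma ideal_sum K (T : Type) (s : seq T) (P : pred T) (F : T -> R) :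
  is_ideal K -> (forall i, P i -> K (F i)) -> K (\sum_(i <- s | P i) F i).
Proof.
move=> hK hF; elim/big_ind: _ => //; first exact: (ideal0 hK).
by move=> x y; apply: (idealD hK).
Qed.

Lemma is_ideal0 : is_ideal [set 0 : R].
Proof.
by split=> //= [x y -> ->|a x ->]; rewrite ?addr0 ?mulr0.
Qed.

Lemma is_idealT : is_ideal [set: R]. Proof. by split. Qed.

Lemma ideal_gen_ideal (A : set R) : is_ideal (ideal_gen A).
Proof.
split=> [K [[]]//|x y Ax Ay K hK|a x Ax K hK]; case: (hK) => idK _.
  by apply: (idealD idK); [apply: Ax|apply: Ay].
by apply: (idealMl _ idK); apply: Ax.
Qed.

Lemma sub_ideal_gen (A : set R) x : A x -> ideal_gen A x.
Proof. by move=> Ax K [_]; apply. Qed.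

Lemma ideal_gen_sub (A K : set R) :
  is_ideal K -> A `<=` K -> ideal_gen A `<=` K.
Proof. exact: smallest_sub. Qed.

Local Opaque ideal_gen.

Lemma ideal_gen_seqP (s : seq R) x :
  ideal_gen [set` s] x <-> exists a : nat -> R, x = \sum_(i < size s) a i * s`_i.
Proof.
split; last first.
  case=> a ->; apply: (ideal_sum _ (ideal_gen_ideal _)) => i _.
  apply: (idealMl _ (ideal_gen_ideal _)).
  by apply: sub_ideal_gen; rewrite /= mem_nth.
apply: (ideal_gen_sub (K := [set x | exists a : nat -> R,
  x = \sum_(i < size s) a i * s`_i])).
  split=> [|_ _ [a ->] [b ->]|c _ [a ->]].
  - by exists (fun=> 0); rewrite big1 // => i _; rewrite mul0r.
  - exists (fun i => a i + b i); rewrite -big_split /=.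
    by apply: eq_bigr => i _; rewrite mulrDl.
  - exists (fun i => c * a i); rewrite mulr_sumr.
    by apply: eq_bigr => i _; rewrite mulrA.
move=> y /= ys; exists (fun i => (i == index y s)%:R).
have iys : (index y s < size s)%N by rewrite index_mem.
rewrite (bigD1 (Ordinal iys)) //= eqxx mul1r nth_index // big1 ?addr0 // => i.
by rewrite -val_eqE /= => /negPf ->; rewrite mul0r.
Qed.

Lemma mem_ideal_gen1 a x : ideal_gen [set a] x <-> exists b, x = b * a.
Proof.
split.
  apply: (ideal_gen_sub (K := [set x | exists b, x = b * a])).
    split=> [|_ _ [b ->] [c ->]|c _ [b ->]].
    - by exists 0; rewrite mul0r.
    - by exists (b + c); rewrite mulrDl.
    - by exists (c * b); rewrite mulrA.
  by move=> _ ->; exists 1; rewrite mul1r.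
case=> b ->; apply: (idealMl _ (ideal_gen_ideal _)).
exact: sub_ideal_gen.
Qed.

Lemma ideal_pow_ideal K n : is_ideal (ideal_pow K n).
Proof. by case: n => [|n] /=; [exact: is_idealT|exact: ideal_gen_ideal]. Qed.

Lemma ideal_powS K n x y : K x -> ideal_pow K n y -> ideal_pow K n.+1 (x * y).
Proof. by move=> Kx Ky; apply: sub_ideal_gen; exists x, y. Qed.

Lemma ideal_powX K n x : K x -> ideal_pow K n (x ^+ n).
Proof. by move=> Kx; elim: n => [//|n IH]; rewrite exprS; apply: ideal_powS. Qed.

Lemma ideal_pow_sub K n : is_ideal K -> ideal_pow K n.+1 `<=` K.
Proof.
move=> hK; apply: ideal_gen_sub => // _ [x [y [Kx _ ->]]]; exact: (idealMr _ hK).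
Qed.

Lemma ideal_pow1 K x : K x -> ideal_pow K 1 x.
Proof. by move=> /(ideal_powX 1); rewrite expr1. Qed.

Definition colon K u : set R := [set r | K (r * u)].

Lemma colon_ideal K u : is_ideal K -> is_ideal (colon K u).
Proof.
move=> hK; split=> [|x y|a x]; rewrite /colon /=.
- by rewrite mul0r; apply: (ideal0 hK).
- by rewrite mulrDl; apply: (idealD hK).
- by rewrite -mulrA; apply: (idealMl _ hK).
Qed.

Lemma sub_colon K u : is_ideal K -> K `<=` colon K u.
Proof. by move=> hK x Kx; apply: (idealMr _ hK). Qed.

Lemma prime_ideal p : is_prime_ideal p -> is_ideal p. Proof. by case. Qed.

Lemma prime_proper p : is_prime_ideal p -> ~ p 1. Proof. by case. Qed.

Lemma primeM p x y : is_prime_ideal p -> ~ p x -> ~ p y -> ~ p (x * y).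
Proof. by case=> _ _ pM px py /pM[]. Qed.

Lemma primeX p x n : is_prime_ideal p -> p (x ^+ n) -> p x.
Proof.
move=> pp; elim: n => [|n IH]; first by rewrite expr0 => /(prime_proper pp).
by rewrite exprS; case: (pp) => _ _ pM /pM[].
Qed.

Lemma prime_prod p (T : Type) (s : seq T) (F : T -> R) :
  is_prime_ideal p -> (forall i, ~ p (F i)) -> ~ p (\prod_(i <- s) F i).
Proof.
move=> pp hF; elim/big_ind: _ => //; first exact: prime_proper.
by move=> x y; apply: primeM.
Qed.

Lemma Spec_ext (p q : Spec R) : spec_set p = spec_set q -> p = q.
Proof.
case: p q => p hp [q hq] /= pq; subst q; congr MkSpec.
exact: Prop_irrelevance.
Qed.

End Ideals.

(** * Noetherian rings: prime colon ideals and prime avoidance *)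

Section Noetherian.
Variable R : comPzRingType.
Hypothesis noethR : noetherian R.
Implicit Types (K L p : set R) (a b c r s u v w x y z : R).

(** Without a maximal member, choice builds a strictly increasing chain in [F]; its union is
    finitely generated, hence contained in one term. *)
Lemma noetherian_max (F : set (set R)) : F `<=` @is_ideal R -> F !=set0 ->
  exists2 K, F K & forall L, F L -> K `<=` L -> L = K.
Proof.
move=> Fid [K0 FK0]; apply: contrapT => nomax.
have step (A : {K | F K}) : {B : {K | F K} | proj1_sig A `<` proj1_sig B}.
  apply: cid; apply: contrapT => nB; apply: nomax.
  exists (proj1_sig A); first exact: (proj2_sig A).
  move=> L FL AL; apply/seteqP; split=> //; apply: contrapT => nLA.
  by apply: nB; exists (exist _ L FL).
pose c n := iter n (fun A => proj1_sig (step A)) (exist _ K0 FK0).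
have cS n : proj1_sig (c n) `<` proj1_sig (c n.+1) by exact: (proj2_sig (step (c n))).
have c_id n : is_ideal (proj1_sig (c n)) by apply: Fid; exact: (proj2_sig (c n)).
have c_mono m n : (m <= n)%N -> proj1_sig (c m) `<=` proj1_sig (c n).
  elim: n => [|n IH]; first by rewrite leqn0 => /eqP ->.
  rewrite leq_eqVlt => /orP[/eqP -> //|/IH]; move=> h x /h; exact: (proj1 (cS n)).
pose U := [set x | exists n, proj1_sig (c n) x].
have hU : is_ideal U.
  split=> [|x y [m hx] [n hy]|a x [n hx]].
  - by exists 0%N; apply: (ideal0 (c_id _)).
  - exists (maxn m n); apply: (idealD (c_id _)).
      by apply: c_mono hx; rewrite leq_maxl.
    by apply: c_mono hy; rewrite leq_maxr.
  - by exists n; apply: (idealMl _ (c_id _)).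
have [s Us] := noethR hU.
have [n hn] : exists n, forall x, x \in s -> proj1_sig (c n) x.
  have : forall x, x \in s -> U x by move=> x xs; rewrite Us; apply: sub_ideal_gen.
  elim: (s) => [|x t IH] hs; first by exists 0%N.
  have [y yt|n hn] := IH; first by apply: hs; rewrite inE yt orbT.
  have [m hm] : U x by apply: hs; rewrite inE eqxx.
  exists (maxn m n) => y; rewrite inE => /orP[/eqP ->|yt].
    by apply: c_mono hm; rewrite leq_maxl.
  by apply: c_mono (hn _ yt); rewrite leq_maxr.
apply: (proj2 (cS n)) => x hx.
have : U x by exists n.+1.
by rewrite Us; apply: ideal_gen_sub.
Qed.

(* A member of U whose colon ideal is maximal has a prime colon ideal. *)
Lemma colon_prime K (U : set R) u0 : is_ideal K -> U u0 ->
  (forall u, U u -> ~ K u) ->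
  (forall u b, U u -> U (b * u) \/ exists2 s, U (s * u) & K (s * (b * u))) ->
  exists2 u, U u & is_prime_ideal (colon K u).
Proof.
move=> hK Uu0 UK Ustep.
have [||_ [u Uu <-] umax] := @noetherian_max [set colon K u | u in U].
- by move=> _ [u _ <-]; apply: colon_ideal.
- by exists (colon K u0); exists u0.
have stable t : U (t * u) -> colon K (t * u) = colon K u.
  move=> Utu; apply: umax; first by exists (t * u).
  by move=> x; rewrite /colon /= mulrCA => /(idealMl t hK).
exists u => //; split; first exact: colon_ideal.
  by rewrite /colon /= mul1r; apply: UK.
move=> a b Kab; have [Ubu|[s Usu Ksbu]] := Ustep u b Uu.
  by left; rewrite -(stable _ Ubu) /colon /= mulrA.
by right; rewrite -(stable _ Usu) /colon /= mulrCA.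
Qed.

(** Applies [colon_prime] to the elements whose class in R/K stays nonzero at [p]; no element
    outside [p] can then lie in the colon ideal. *)
Lemma colon_prime_under K p : is_ideal K -> is_prime_ideal p -> K `<=` p ->
  exists2 u, is_prime_ideal (colon K u) & colon K u `<=` p.
Proof.
move=> hK pp Kp.
have [||u b hu|u hu up] := @colon_prime K [set u | forall s, ~ p s -> ~ K (s * u)] 1 hK.
- by move=> s ps; rewrite mulr1 => /Kp.
- by move=> u /(_ 1) + Ku; rewrite mul1r; apply=> //; apply: prime_proper.
- have [|/existsNP[s /not_implyP[ps /contrapT Ksbu]]] :=
    pselect (forall s, ~ p s -> ~ K (s * (b * u))); first by left.
  right; exists s => // t pt; rewrite mulrA; apply: hu; exact: primeM.
- by exists u => // r Kru; apply: contrapT => /hu.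
Qed.

(** Applies [colon_prime] to the multiples of [w] outside [K]; colon ideals only grow along
    multiples. *)
Lemma colon_prime_above K w : is_ideal K -> ~ K w ->
  exists2 r, is_prime_ideal (colon K (r * w)) & colon K w `<=` colon K (r * w).
Proof.
move=> hK Kw.
have [|_ [_ //]|_ b [[r ->] Krw]|_ [[r ->] Krw] up] :=
    @colon_prime K [set u | (exists r, u = r * w) /\ ~ K u] w hK.
- by split=> //; exists 1; rewrite mul1r.
- have [Kbu|Kbu] := pselect (K (b * (r * w))).
    by right; exists 1; rewrite mul1r //; split=> //; exists r.
  by left; split=> //; exists (b * r); rewrite mulrA.
- by exists r => // x; rewrite /colon /= mulrCA; apply: (idealMl _ hK).
Qed.

Lemma finite_subgen (A : set R) : exists n (c : nat -> R),
  (forall i, (i < n)%N -> A (c i)) /\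
  forall x, A x -> exists a : nat -> R, x = \sum_(i < n) a i * c i.
Proof.
pose F := [set ideal_gen [set` mkseq nc.2 nc.1] | nc in
  [set nc : nat * (nat -> R) | forall i, (i < nc.1)%N -> A (nc.2 i)]].
have [||_ [[n c] /= Ac <-] cmax] := @noetherian_max F.
- by move=> _ [nc _ <-]; apply: ideal_gen_ideal.
- by exists (ideal_gen [set` mkseq (fun=> 0) 0]); exists (0%N, fun=> 0).
exists n, c; split=> // x Ax.
suff /ideal_gen_seqP[a ->] : ideal_gen [set` mkseq c n] x.
  exists a; rewrite size_mkseq; apply: eq_bigr => i _.
  by rewrite nth_mkseq.
pose c' i := if (i < n)%N then c i else x.
have c'x : x \in mkseq c' n.+1.
  apply/mapP; exists n; first by rewrite mem_iota add0n leqnn.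
  by rewrite /c' ltnn.
rewrite -(cmax (ideal_gen [set` mkseq c' n.+1])).
- exact: sub_ideal_gen.
- exists (n.+1, c') => //= i _; rewrite /c'; case: ifPn => // ?; exact: Ac.
- apply: ideal_gen_sub; first exact: ideal_gen_ideal.
  move=> y /= /mapP[i]; rewrite mem_iota add0n => /andP[_ lin] ->.
  apply: sub_ideal_gen => /=; apply/mapP; exists i.
    by rewrite mem_iota add0n leqW.
  by rewrite /c' lin.
Qed.

(** Finitely many elements c_i generate all u whose colon ideal is in [P]. If p = (K : u) differed
    from each (K : c_i), incomparability would give r_i in (K : c_i) outside p; their product
    multiplies u into [K], so it lies in p. *)
Lemma incomparable_colon_finite K (P : set (set R)) : is_ideal K ->
  (forall p, P p -> is_prime_ideal p /\ exists u, p = colon K u) ->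
  (forall p q, P p -> P q -> p `<=` q -> p = q) ->
  exists n (c : nat -> set R), (forall i, (i < n)%N -> P (c i)) /\
    forall p, P p -> exists2 i, (i < n)%N & p = c i.
Proof.
move=> hK Pcolon Pinc.
have [n [c [Pc genc]]] := finite_subgen [set u | P (colon K u)].
exists n, (fun i => colon K (c i)); split=> // p Pp.
have [pp [u pu]] := Pcolon p Pp; apply: contrapT => np.
have [r hr] : {r : nat -> R & forall i, (i < n)%N -> K (r i * c i) /\ ~ p (r i)}.
  apply: (@choice _ _ (fun i ri => (i < n)%N -> K (ri * c i) /\ ~ p ri)) => i.
  have [lin|] := ltnP i n; last by exists 0.
  apply: contrapT => nr; apply: np; exists i => //.
  apply/esym/Pinc => //; first exact: Pc.
  by move=> x Kx; apply: contrapT => px; apply: nr; exists x.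
have pr : ~ p (\prod_(i < n) r i).
  by apply: prime_prod => // i; apply: (proj2 (hr i _)).
have [|a ua] := genc u; first by rewrite /= -pu.
apply: pr; rewrite pu /colon /= ua mulr_sumr; apply: ideal_sum => // i _.
have [Kc _] := hr i (ltn_ord i); rewrite (bigD1 i) //=.
rewrite (_ : _ * _ = (\prod_(j < n | j != i) r j * a i) * (r i * c i)).
  exact: (idealMl _ hK).
by ring.
Qed.

Lemma prime_avoidance K n (c : nat -> set R) : is_ideal K ->
  (forall i, (i < n)%N -> is_prime_ideal (c i)) ->
  (forall i j, (i < n)%N -> (j < n)%N -> c i `<=` c j -> c i = c j) ->
  (forall i, (i < n)%N -> ~ K `<=` c i) ->
  exists2 d, K d & forall i, (i < n)%N -> ~ c i d.
Proof.
move=> hK; elim: n => [|n IH] cP cinc Kc.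
  by exists 0 => //; apply: (ideal0 hK).
have [|||d Kd hd] := IH.
- by move=> i lin; apply: cP; apply: leqW.
- by move=> i j lin ljn; apply: cinc; apply: leqW.
- by move=> i lin; apply: Kc; apply: leqW.
have pn := cP n (ltnSn n).
have [cnd|cnd] := pselect (c n d); last first.
  exists d => // i; rewrite ltnS leq_eqVlt => /orP[/eqP -> //|]; exact: hd.
have [y Ky cny] : exists2 y, K y & ~ c n y.
  have /existsNP[y /not_implyP[Ky cny]] := Kc n (ltnSn n).
  by exists y.
have [z hz] : {z : nat -> R & forall i, (i < n)%N -> c i (z i) /\ ~ c n (z i)}.
  apply: (@choice _ _ (fun i zi => (i < n)%N -> c i zi /\ ~ c n zi)) => i.
  have [lin|] := ltnP i n; last by exists 0.
  have /existsNP[x /not_implyP[cx cnx]] : ~ c i `<=` c n; last by exists x.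
  move=> /(cinc _ _ (leqW lin) (ltnSn n)) cin.
  by apply: (hd i lin); rewrite cin.
(* [d] avoids all the primes but the last, and [e] lies in all of them but the last; so [d + e]
   avoids every one. *)
pose e := y * \prod_(i < n) z i.
have cne : ~ c n e.
  apply: (primeM pn) => //; apply: prime_prod => // i.
  exact: (proj2 (hz i _)).
exists (d + e); first by apply: (idealD hK) => //; apply: (idealMr _ hK).
move=> i; rewrite ltnS leq_eqVlt => /orP[/eqP ->|lin] hde.
  by apply: cne; rewrite -[e](addKr d) addrC; apply: (idealB (prime_ideal pn)).
have ip := prime_ideal (cP i (leqW lin)).
apply: (hd i lin); rewrite -[d](addrK e); apply: (idealB ip) => //.
rewrite /e (bigD1 (Ordinal lin)) //= mulrCA; apply: (idealMr _ ip).
exact: (proj1 (hz i lin)).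
Qed.

(** The zero divisors lie in the maximal annihilators of nonzero elements. These are pairwise
    incomparable primes, hence finitely many, and prime avoidance finds an element of [K] outside
    all of them. *)
Lemma exists_nonzerodivisor K : is_ideal K ->
  (forall x, is_prime_ideal (colon [set 0] x) -> ~ K `<=` colon [set 0] x) ->
  exists2 d, K d & forall x, d * x = 0 -> x = 0.
Proof.
move=> hK KP.
pose P := [set p : set R | exists u, [/\ u <> 0, p = colon [set 0] u &
  forall v, v <> 0 -> p `<=` colon [set 0] v -> colon [set 0] v = p]].
have Pp p : P p -> is_prime_ideal p.
  move=> [u [u0 pu pmax]].
  have [r rp rs] := @colon_prime_above [set 0] u (is_ideal0 R) u0.
  rewrite -(pmax (r * u)) ?pu // => ru0; apply: (prime_proper rp).
  by rewrite /colon /= mul1r.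
have [||n [c [Pc cP]]] := @incomparable_colon_finite [set 0] P (is_ideal0 R).
- by move=> p [u up]; split; [apply: Pp; exists u|exists u; case: up].
- by move=> _ _ [u [u0 -> umax]] [v [v0 -> _]] /umax ->.
have [|||d Kd hd] := @prime_avoidance K n c hK.
- by move=> i /Pc/Pp.
- by move=> i j /Pc[u [u0 -> umax]] /Pc[v [v0 -> _]] /umax ->.
- by move=> i /Pc Pi; have := Pp _ Pi; case: Pi => u [_ -> _] /KP.
exists d => // x dx0; apply: contrapT => x0.
have [||p [u [u0 xu] <-] pmax] := @noetherian_max
    [set colon [set 0] u | u in [set u | u <> 0 /\ colon [set 0] x `<=` colon [set 0] u]].
- by move=> _ [u _ <-]; apply: colon_ideal; exact: is_ideal0.
- by exists (colon [set 0] x); exists x => //; split=> // z.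
have [|i /hd + cu] := cP (colon [set 0] u); last by apply; rewrite -cu; apply: xu.
exists u; split=> // v v0 uv; apply: pmax => //; exists v => //; split=> //.
exact: subset_trans uv.
Qed.

End Noetherian.

(** * The determinant trick over an integrally closed ideal *)

Section DeterminantTrick.
Variable R : comPzRingType.
Local Arguments ideal_pow : simpl never.
Implicit Types (K L : set R) (a b c r s u v w x y z : R).

(* For K0 = R this is the set of the sums of the b_i c^(n - i) with
   0 <= i <= n and b_i in K^i; for K0 = 0 the term i = 0 is missing. *)
Fixpoint weighted K c (K0 : set R) n : set R :=
  if n is m.+1 then
    [set c * xb.1 + xb.2 | xb in weighted K c K0 m `*` ideal_pow K n]
  else K0.

Local Arguments weighted : simpl never.

Lemma weighted_ideal K c K0 n : is_ideal K0 -> is_ideal (weighted K c K0 n).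
Proof.
move=> hK0; elim: n => [//|n IH].
have Kid := ideal_pow_ideal K n.+1.
split=> [|_ _ [[x b] [/= Wx Kb] <-] [[y d] [/= Wy Kd] <-]|a _ [[x b] [/= Wx Kb] <-]].
- exists (0, 0); last by rewrite /= mulr0 addr0.
  by split; [apply: (ideal0 IH)|apply: (ideal0 Kid)].
- exists (x + y, b + d); last by rewrite /=; ring.
  by split; [apply: (idealD IH)|apply: (idealD Kid)].
- exists (a * x, a * b); last by rewrite /=; ring.
  by split; [apply: (idealMl _ IH)|apply: (idealMl _ Kid)].
Qed.

Lemma weightedMl K c K0 n x :
  weighted K c K0 n x -> weighted K c K0 n.+1 (c * x).
Proof.
move=> Wx; exists (x, 0); last by rewrite /= addr0.
by split=> //; apply: (ideal0 (ideal_pow_ideal K n.+1)).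
Qed.

Lemma sub_weighted K c K0 n : weighted K c K0 n `<=` weighted K c setT n.
Proof. by elim: n => [//|n IH] x [[y b] [/= /IH Wy Kb] <-]; exists (y, b). Qed.

(** A factor in [K] raises every K-degree by one, so the pure power of [c] disappears. *)
Lemma weighted0_Ml K c a n x :
  K a -> weighted K c setT n x -> weighted K c [set 0] n.+1 (a * x).
Proof.
move=> Ka; elim: n x => [x _|n IH _ [[x b] [/= Wx Kb] <-]].
  exists (0, a * x); last by rewrite /= mulr0 add0r.
  by split=> //=; apply: (idealMr _ (ideal_pow_ideal K 1)); apply: ideal_pow1.
exists (a * x, a * b); last by rewrite /=; ring.
by split; [exact: IH|exact: (ideal_powS Ka Kb)].
Qed.

Lemma weighted_scale K c s n x :
  weighted K c [set 0] n x -> weighted K (s * c) [set 0] n (s ^+ n * x).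
Proof.
elim: n x => [_ ->|n IH _ [[x b] [/= Wx Kb] <-]]; first by rewrite mulr0.
exists (s ^+ n * x, s ^+ n.+1 * b); last by rewrite /= exprS; ring.
by split; [exact: IH|apply: (idealMl _ (ideal_pow_ideal K n.+1))].
Qed.

Lemma weighted_sum K c n x : weighted K c [set 0] n x ->
  exists2 a : nat -> R, forall i, (0 < i <= n)%N -> ideal_pow K i (a i) &
    x = \sum_(1 <= i < n.+1) a i * c ^+ (n - i).
Proof.
elim: n x => [_ ->|n IH _ [[x b] [/= /IH[a Ka ->] Kb] <-]].
  by exists (fun=> 0) => [[|i] /andP[]//|]; rewrite big_geq.
exists (fun i => if i == n.+1 then b else a i) => [i|].
  case: eqP => [-> //|/eqP in1] /andP[i0 ile]; apply: Ka.
  by rewrite i0 -ltnS ltn_neqAle in1.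
rewrite [RHS]big_nat_recr //= eqxx subnn mulr1; congr (_ + _).
rewrite mulr_sumr; apply: eq_big_nat => i /andP[_ ilt].
by rewrite ltn_eqF // subSn // exprS mulrCA.
Qed.

Lemma integral_of_weighted K c n x :
  integrally_closed K -> weighted K c [set 0] n.+1 x -> c ^+ n.+1 + x = 0 -> K c.
Proof.
move=> icK /weighted_sum[a Ka ->] eq0.
by rewrite -icK; exists n.+1, a; split.
Qed.

(** Such products are the Leibniz terms of det (c - B): [e i] tells whether the i-th factor is a
    diagonal entry. A single factor off the diagonal removes the pure power of [c]. *)
Lemma weighted_prod K c (T : Type) (r : seq T) (e : T -> bool) (b : T -> R) :
  is_ideal K -> (forall i, K (b i)) ->
  weighted K c (if all e r then setT else [set 0]) (size r)
    (\prod_(i <- r) (c *+ e i - b i)).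
Proof.
move=> hK hb; elim: r => [|i r IH] /=; first by rewrite big_nil.
rewrite big_cons mulrBl.
have hI : is_ideal (if e i && all e r then [set: R] else [set 0]).
  by case: ifP => _; [exact: is_idealT|exact: is_ideal0].
have : weighted K c [set 0] (size r).+1 (b i * \prod_(j <- r) (c *+ e j - b j)).
  by apply: weighted0_Ml => //; apply: sub_weighted IH.
set W := weighted _ _ _ _ => W0.
have sW : W `<=` weighted K c (if e i && all e r then setT else [set 0]) (size r).+1.
  by rewrite /W; case: ifP => _ x Wx; [apply: sub_weighted Wx|].
apply: (idealB (weighted_ideal _ _ _ hI)); last exact: sW.
case: (e i) hI {sW} => //= hI; first by rewrite mulr1n; apply: weightedMl.
rewrite mulr0n mul0r; exact: (ideal0 (weighted_ideal K c (size r).+1 hI)).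
Qed.

Lemma weighted_prod_diag K c (T : Type) (r : seq T) (b : T -> R) :
  is_ideal K -> (forall i, K (b i)) ->
  weighted K c [set 0] (size r) (\prod_(i <- r) (c - b i) - c ^+ size r).
Proof.
move=> hK hb; elim: r => [|i r IH]; first by rewrite big_nil subrr.
rewrite big_cons /= exprS.
have -> : (c - b i) * \prod_(j <- r) (c - b j) - c * c ^+ size r =
  c * (\prod_(j <- r) (c - b j) - c ^+ size r) - b i * \prod_(j <- r) (c - b j).
  by ring.
apply: (idealB (weighted_ideal K c (size r).+1 (is_ideal0 R))).
  exact: weightedMl.
apply: weighted0_Ml => //.
have := @weighted_prod K c T r (fun=> true) b hK hb.
by rewrite all_predT.
Qed.

Lemma weighted_det K c n (B : 'M[R]_n) : is_ideal K -> (forall i j, K (B i j)) ->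
  weighted K c [set 0] n (\det (c%:M - B) - c ^+ n).
Proof.
move=> hK hB; have W0 := weighted_ideal K c n (is_ideal0 R).
rewrite /determinant (bigD1 (1%g : {perm _})) //= odd_perm1 expr0 mul1r addrAC.
apply: (idealD W0).
  have := @weighted_prod_diag K c _ (enum 'I_n) (fun i => B i i) hK (fun i => hB i i).
  rewrite size_enum_ord big_enum /=; congr (weighted _ _ _ _ (_ - _)).
  by apply: eq_bigr => i _; rewrite perm1 !mxE eqxx mulr1n.
apply: (ideal_sum _ W0) => s s1; apply: (idealMl _ W0).
have := @weighted_prod K c _ (enum 'I_n) (fun i => i == s i) (fun i => B i (s i)) hK
  (fun i => hB i _).
rewrite size_enum_ord big_enum /=.
rewrite (_ : all _ _ = false).
  by congr (weighted _ _ _ _ _); apply: eq_bigr => i _; rewrite !mxE.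
apply: contraNF s1 => /allP fix_s; apply/eqP/permP => i; rewrite perm1.
by apply/esym/eqP/fix_s; rewrite mem_enum.
Qed.

Definition ideal_mul K L : set R :=
  ideal_gen [set z | exists x y, [/\ K x, L y & z = x * y]].

Lemma mem_ideal_mul K L x y : K x -> L y -> ideal_mul K L (x * y).
Proof. by move=> Kx Ly; apply: sub_ideal_gen; exists x, y. Qed.

Lemma ideal_mul_gen K n (z : 'I_n -> R) L l : is_ideal K ->
  (forall y, L y -> exists a : 'I_n -> R, y = \sum_i a i * z i) ->
  ideal_mul K L l ->
  exists2 a : 'I_n -> R, (forall i, K (a i)) & l = \sum_i a i * z i.
Proof.
move=> hK hL; apply: (ideal_gen_sub (K := [set l | exists2 a : 'I_n -> R,
  (forall i, K (a i)) & l = \sum_i a i * z i])).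
  split=> [|_ _ [a Ka ->] [b Kb ->]|c _ [a Ka ->]].
  - exists (fun=> 0) => [i|]; first exact: (ideal0 hK).
    by rewrite big1 // => i _; rewrite mul0r.
  - exists (fun i => a i + b i) => [i|]; first exact: (idealD hK).
    by rewrite -big_split /=; apply: eq_bigr => i _; rewrite mulrDl.
  - exists (fun i => c * a i) => [i|]; first exact: (idealMl _ hK).
    by rewrite mulr_sumr; apply: eq_bigr => i _; rewrite mulrA.
move=> _ [x [y [Kx /hL[a ->] ->]]].
exists (fun i => x * a i) => [i|]; first exact: (idealMr _ hK).
by rewrite mulr_sumr; apply: eq_bigr => i _; rewrite mulrA.
Qed.

(** With generators z of [L], write c z = B z with the entries of B in [K]. By the adjugate, D = det
    (c - B) kills [L], so s D = 0; multiplied by s^n, D becomes an equation of integral dependence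
    for s c over [K]. *)
Lemma determinant_trick K L c s : noetherian R -> is_ideal K ->
  integrally_closed K -> is_ideal L ->
  (forall l, L l -> ideal_mul K L (c * l)) ->
  (forall y, (forall l, L l -> y * l = 0) -> s * y = 0) -> K (s * c).
Proof.
move=> noethR hK icK hL cL sL; have [t Lt] := noethR L hL.
set n := size t; pose z (i : 'I_n) := t`_i.
have Lz i : L (z i) by rewrite Lt; apply: sub_ideal_gen; rewrite /= mem_nth.
have genL y : L y -> exists a : 'I_n -> R, y = \sum_i a i * z i.
  by rewrite Lt => /ideal_gen_seqP[a ->]; exists (fun i => a i).
have [B hB] : {B : 'I_n -> 'I_n -> R & forall i,
    (forall j, K (B i j)) /\ c * z i = \sum_j B i j * z j}.
  apply: (@choice _ _ (fun i g => (forall j, K (g j)) /\ c * z i = \sum_j g j * z j)).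
  by move=> i; have [a Ka e] := ideal_mul_gen hK genL (cL _ (Lz i)); exists a.
pose M := \matrix_(i, j) B i j; pose D := \det (c%:M - M).
have MK i j : K (M i j) by rewrite mxE; apply: (proj1 (hB i)).
have Dz i : D * z i = 0.
  have Mz0 : (c%:M - M) *m \col_j z j = 0.
    apply/colP => k; rewrite mulmxBl mul_scalar_mx !mxE (proj2 (hB k)).
    apply/eqP; rewrite subr_eq0; apply/eqP/eq_bigr => j _.
    by rewrite !mxE.
  have := congr1 (mulmx (\adj (c%:M - M))) Mz0.
  rewrite mulmxA mul_adj_mx mul_scalar_mx mulmx0 => /colP/(_ i).
  by rewrite !mxE.
have /sL sD0 l : L l -> D * l = 0.
  move=> /genL[a ->]; rewrite mulr_sumr big1 // => i _.
  by rewrite mulrCA Dz mulr0.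
have := weighted_det c hK MK; rewrite -/D.
case: (n) => [|m] /= WD.
  (* Without generators the determinant is 1, so [s] is 0. *)
  move: WD; rewrite expr0 => /eqP; rewrite subr_eq0 => /eqP D1.
  by move: sD0; rewrite D1 mulr1 => ->; rewrite mul0r; apply: (ideal0 hK).
apply: integral_of_weighted icK (weighted_scale s WD) _.
by rewrite exprMn -mulrDr addrC subrK exprS mulrAC sD0 mul0r.
Qed.

End DeterminantTrick.

(** * Suprema of sets of naturals *)

Section Suprema.
Implicit Types A : set nat.

Lemma sup_nat_supremums A : A !=set0 ->
  supremums [set (Posz n)%:E%E | n in A] !=set0.
Proof.
case=> n0 An0; have [[k Ak]|unb] := pselect (exists k, forall n, A n -> (n <= k)%N).
  have exA : exists n, `[< A n >] by exists n0; apply/asboolP.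
  have bndA n : `[< A n >] -> (n <= k)%N by move=> /asboolP /Ak.
  case: (ex_maxnP exA bndA) => m /asboolP Am maxm; exists (Posz m)%:E%E.
  split=> [_ [n An <-]|u]; last by apply; exists m.
  by rewrite lee_fin lez_nat; apply: maxm; apply/asboolP.
exists +oo%E; split=> [_ [n _ <-]|[z||] ubz]; rewrite ?leey //.
  case: unb; exists `|z|%N => n An.
  have := ubz _ (ex_intro2 _ _ n An erefl); rewrite lee_fin => nz.
  by rewrite -lez_nat gez0_abs // (le_trans _ nz).
by have := ubz _ (ex_intro2 _ _ n0 An0 erefl).
Qed.

Lemma sup_nat_ge A n : A n -> ((Posz n)%:E <= sup_nat A)%E.
Proof.
move=> An; apply: ge_supremum_Nmem; last by exists n.
by apply: sup_nat_supremums; exists n.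
Qed.

Lemma sup_nat_le A k : (forall n, A n -> (n <= k)%N) -> (sup_nat A <= (Posz k)%:E)%E.
Proof.
move=> Ak; rewrite /sup_nat /supremum; case: ifPn => [_|/set0P[_ [n An _]]].
  exact: leNye.
have [s hs] : supremums [set (Posz n)%:E%E | n in A] !=set0.
  by apply: sup_nat_supremums; exists n.
case: xgetP => [y _ [_ lb]|/(_ s)//]; apply: lb => _ [m /Ak mk <-].
by rewrite lee_fin lez_nat.
Qed.

End Suprema.

(** * Upper bounds for the depth *)

Section DepthBounds.
Variables (A : comPzRingType) (m : set A).

Lemma depth_le0 x : x <> 0 -> (forall y, m y -> y * x = 0) -> (depth m <= 0)%E.
Proof.
move=> x0 mx; apply: (@sup_nat_le _ 0) => _ [s [<- sm [_ reg]]].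
case: s sm reg => // y s sm /(_ 0%N isT x) /=.
rewrite mx; last by apply: sm; rewrite mem_head.
have set0E : [set` [::]] = set0 :> set A by apply/seteqP; split=> // z.
have gen0 : ideal_gen [set` [::]] `<=` [set 0 : A].
  by apply: ideal_gen_sub; [exact: is_ideal0|rewrite set0E].
by move=> /(_ (ideal0 (ideal_gen_ideal _)))/gen0/x0.
Qed.

(* If y, z is a regular sequence in m, then y b = a c for some c with z c in (y),
   so that c is in (y), and b in (a). *)
Lemma depth_le1 a b : (forall x, a * x = 0 -> x = 0) ->
  ~ (exists c, b = a * c) -> (forall y, m y -> exists c, y * b = a * c) ->
  (depth m <= 1)%E.
Proof.
move=> a0 ba mb; apply: (@sup_nat_le _ 1) => _ [s [<- sm [_ reg]]].
case: s sm reg => [//|y [//|z s]] sm reg; exfalso; apply: ba.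
have [c yc] : exists c, y * b = a * c by apply/mb/sm; rewrite mem_head.
have [e ze] : exists e, z * b = a * e by apply/mb/sm; rewrite !inE eqxx orbT.
have genP w : ideal_gen [set` [:: y]] w <-> exists g, w = g * y.
  rewrite -mem_ideal_gen1; rewrite (_ : [set` [:: y]] = [set y]) //.
  by apply/seteqP; split=> x /=; rewrite inE => /eqP.
have /genP[g cg] : ideal_gen [set` [:: y]] c.
  apply: (reg 1%N) => //=; apply/genP; exists e.
  have : a * (z * c - e * y) = 0.
    rewrite (_ : _ * _ = z * (a * c) - y * (a * e)); last by ring.
    by rewrite -yc -ze; ring.
  by move=> /a0 /eqP; rewrite subr_eq0 => /eqP.
have y0 w : y * w = 0 -> w = 0.
  move=> yw; have gen0 : ideal_gen [set` [::]] `<=` [set 0 : A].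
    by apply: ideal_gen_sub; [exact: is_ideal0|move=> ?].
  apply: gen0; apply: (reg 0%N) => //=; rewrite yw.
  exact: (ideal0 (ideal_gen_ideal _)).
exists g; have : y * (b - a * g) = 0 by rewrite mulrBr yc cg; ring.
by move=> /y0 /eqP; rewrite subr_eq0 => /eqP.
Qed.

End DepthBounds.

(** * The local ring at a prime, and consequences of (S_2) *)

Section LocalRing.
Variables (R : comPzRingType) (p : Spec R).
Implicit Types (J q : set R) (a b r u : R) (s t : denom p).

Definition fr r s : locring p := Defs.frac (r : R^o) s.

Definition mkden u (pu : ~ spec_set p u) : denom p := exist _ u (asboolT pu).

Lemma den_mkden u (pu : ~ spec_set p u) : den (mkden pu) = u. Proof. by []. Qed.

Lemma fr_ind (P : locring p -> Prop) : (forall r s, P (fr r s)) -> forall x, P x.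
Proof. by move=> H; elim/frac_ind => r s; apply: H. Qed.

Lemma fr_eq a s b t : fr a s = fr b t <->
  exists2 u, ~ spec_set p u & u * den t * a = u * den s * b.
Proof.
split=> [/fracP[u e]|[u pu e]].
  by exists (den u); [exact: denomP|].
by apply/fracP; exists (mkden pu).
Qed.

Lemma frD a s b t : fr a s + fr b t = fr (den t * a + den s * b) (denomM s t).
Proof. exact: fracD. Qed.

Lemma frM a s b t : fr a s * fr b t = fr (a * b) (denomM s t).
Proof. exact: loc_scaleE. Qed.

Lemma fr_eq0 a s : fr a s = 0 <-> exists2 u, ~ spec_set p u & u * a = 0.
Proof.
rewrite [0](_ : _ = fr 0 (denom1 p)) // fr_eq; split=> -[u pu].
  by rewrite !mulr0 den1 mulr1 => e; exists u.
by move=> e; exists u => //; rewrite den1 mulr1 e !mulr0.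
Qed.

Lemma loc_extensionP J x : is_ideal J ->
  loc_extension p J x <-> exists r s, J r /\ x = fr r s.
Proof.
move=> hJ; split.
  apply: (ideal_gen_sub (K := [set x | exists r s, J r /\ x = fr r s])); last first.
    by move=> _ [r Jr <-]; exists r, (denom1 p).
  split=> [|_ _ [a [s [Ja ->]]] [b [t [Jb ->]]]|z _ [a [s [Ja ->]]]].
  - exists 0, (denom1 p); split=> //; exact: (ideal0 hJ).
  - exists (den t * a + den s * b), (denomM s t); split; last exact: frD.
    by apply: (idealD hJ); apply: (idealMl _ hJ).
  - elim/fr_ind: z => r t; exists (r * a), (denomM t s); split; last exact: frM.
    exact: (idealMl _ hJ).
case=> r [s [Jr ->]].
have -> : fr r s = fr 1 s * to_locring p r.
  rewrite [RHS]frM; apply/fr_eq; exists 1; first exact: (prime_proper (specP p)).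
  by rewrite !(denM, den1); ring.
rewrite /loc_extension; apply: (idealMl _ (ideal_gen_ideal _)).
by apply: sub_ideal_gen; exists r.
Qed.

Lemma symbolic_powerP n r : symbolic_power p n r <->
  exists2 s, ~ spec_set p s & ideal_pow p n (s * r).
Proof.
rewrite /symbolic_power /= loc_extensionP; last exact: ideal_pow_ideal.
split=> [[a [s [Ja /fr_eq[u pu e]]]]|[s ps Ja]].
  exists (u * den s); first exact: (primeM (specP p) pu (@denomP _ _ s)).
  by rewrite e; apply: (idealMl _ (ideal_pow_ideal _ _)).
exists (s * r), (mkden ps); split=> //; apply/fr_eq.
exists 1; first exact: (prime_proper (specP p)).
by rewrite den_mkden !(denM, den1); ring.
Qed.

Definition loc_set q : set (locring p) := [set x | exists r s, q r /\ x = fr r s].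

Lemma loc_setP q r s : is_prime_ideal q -> q `<=` p -> loc_set q (fr r s) <-> q r.
Proof.
move=> pq qp; split=> [[a [t [qa /fr_eq[u pu e]]]]|qr]; last by exists r, s.
have : q (u * den t * r) by rewrite e; apply: (idealMl _ (prime_ideal pq)).
case: (pq) => _ _ qM /qM[/qM[/qp/pu//|/qp]|//].
by move/(@denomP _ _ t).
Qed.

Lemma loc_set_prime q : is_prime_ideal q -> q `<=` p -> is_prime_ideal (loc_set q).
Proof.
move=> pq qp; have qI := prime_ideal pq; split.
- split=> [|x y|a x].
  + exists 0, (denom1 p); split=> //; exact: (ideal0 qI).
  + elim/fr_ind: x => a s; elim/fr_ind: y => b t.
    rewrite frD !loc_setP // => qa qb.
    by apply: (idealD qI); apply: (idealMl _ qI).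
  + elim/fr_ind: a => a s; elim/fr_ind: x => b t.
    rewrite frM !loc_setP //; exact: (idealMl _ qI).
- rewrite (_ : 1 = fr 1 (denom1 p)) // loc_setP //; exact: (prime_proper pq).
- elim/fr_ind=> a s; elim/fr_ind=> b t.
  by rewrite frM !loc_setP //; case: (pq) => _ _ pM /pM.
Qed.

Lemma krull_dim_locring_ge (c : nat -> Spec R) n : prime_chain c n -> c n = p ->
  ((Posz n)%:E <= krull_dim (locring p))%E.
Proof.
move=> chain cn; apply: sup_nat_ge.
have cp i : (i <= n)%N -> c i `<=` p.
  rewrite -cn; elim: (n) chain => [|k IH] chain.
    by rewrite leqn0 => /eqP ->.
  rewrite leq_eqVlt => /orP[/eqP -> //|]; rewrite ltnS => ik x cx.
  apply: (proj1 (chain k (ltnSn k))); apply: IH ik x cx => j jk.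
  by apply: chain; apply: leqW.
have pp : p `<=` p by [].
(* Beyond [n] the terms of [c] need not lie in [p]; the extension of [p] serves as a default
   there. *)
pose c' i := match pselect (c i `<=` p) with
  | left h => MkSpec (loc_set_prime (specP (c i)) h)
  | right _ => MkSpec (loc_set_prime (specP p) pp)
  end.
have c'P i r s : (i <= n)%N -> spec_set (c' i) (fr r s) <-> spec_set (c i) r.
  move=> /cp ip; rewrite /c'; case: pselect => // ip' /=.
  by rewrite loc_setP //; apply: specP.
exists c' => i lin; have [sub nsub] := chain i lin; split.
  elim/fr_ind => r s cr; apply/(c'P _ _ _ lin); apply: sub.
  exact: (proj1 (c'P _ _ _ (ltnW lin)) cr).
move=> h; apply: nsub => r cr; apply/(c'P _ _ (denom1 p) (ltnW lin)); apply: h.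
exact: (proj2 (c'P _ _ _ lin) cr).
Qed.

(** Since k < 2, the minimum of 2 and dim R_p can be at most k only if dim R_p is, and this bounds
    the chains ending at [p]. *)
Lemma serre2_height k (c : nat -> Spec R) n : (k < 2)%N -> serre_condition R 2 ->
  (depth (loc_extension p p) <= (Posz k)%:E)%E ->
  prime_chain c n -> c n = p -> (n <= k)%N.
Proof.
move=> k2 S2 dk chain cn; have := le_trans (S2 p) dk.
rewrite ge_min lee_fin lez_nat leqNgt k2 /= => dimk.
by have := le_trans (krull_dim_locring_ge chain cn) dimk; rewrite lee_fin lez_nat.
Qed.

(** The image of [x] in R_p is nonzero and killed by the maximal ideal, so the depth is at most
    0. *)
Lemma serre2_ann_height (x : R) (c : nat -> Spec R) n : serre_condition R 2 ->
  spec_set p = colon [set 0] x -> prime_chain c n -> c n = p -> n = 0%N.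
Proof.
move=> S2 px chain cn; apply/eqP; rewrite -leqn0.
apply: (serre2_height _ S2) chain cn => //.
apply: (@depth_le0 _ _ (fr x (denom1 p))).
  by move=> /fr_eq0[u + ux]; apply; rewrite px.
move=> y /(loc_extensionP _ (prime_ideal (specP p)))[r [s [pr ->]]].
rewrite frM fr_eq0; exists 1; first exact: (prime_proper (specP p)).
by rewrite mul1r; move: pr; rewrite px.
Qed.

(** The image of [b] is a nonzero element of R_p / d R_p killed by the maximal ideal, and [d] stays
    regular in R_p; so the depth is at most 1. *)
Lemma serre2_colon_height d b (c : nat -> Spec R) n : serre_condition R 2 ->
  (forall x, d * x = 0 -> x = 0) -> spec_set p = colon [set d * x | x in setT] b ->
  prime_chain c n -> c n = p -> (n <= 1)%N.
Proof.
move=> S2 d0 pb chain cn.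
apply: (serre2_height _ S2) chain cn => //.
apply: (@depth_le1 _ _ (fr d (denom1 p)) (fr b (denom1 p))).
- elim/fr_ind=> r s; rewrite frM !fr_eq0 => -[u pu].
  by rewrite mulrCA => /d0 e; exists u.
- case; elim/fr_ind=> r s; rewrite frM => /fr_eq[u pu].
  rewrite denM !den1 mul1r mulr1 => e.
  have : ~ spec_set p (u * den s) by apply: (primeM (specP p) pu); exact: denomP.
  by apply; rewrite pb; exists (u * r) => //; rewrite mulrCA.
- move=> y /(loc_extensionP _ (prime_ideal (specP p)))[r [s [+ ->]]].
  rewrite pb => -[x _ dx]; exists (fr x s).
  rewrite !frM -dx; apply/fr_eq; exists 1; first exact: (prime_proper (specP p)).
  by rewrite !(denM, den1); ring.
Qed.

End LocalRing.

(** * Height of an ideal *)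

Section Height.
Variable R : comPzRingType.

Lemma prime_height_ge0 (p : Spec R) : (0 <= prime_height p)%E.
Proof. by apply: (@sup_nat_ge _ 0); exists (fun=> p). Qed.

Lemma ideal_height_gt0 (K : set R) (p : Spec R) : (0 < ideal_height K)%E ->
  K `<=` p -> exists c n, [/\ prime_chain c n, c n = p & (0 < n)%N].
Proof.
move=> + Kp; apply: contraPP => nchain.
have p0 : prime_height p = 0%E.
  apply/eqP; rewrite eq_le prime_height_ge0 andbT; apply: (@sup_nat_le _ 0) => n [c ch cn].
  by rewrite leqNgt; apply/negP => n0; apply: nchain; exists c, n.
set H := [set prime_height p | p in [set p : Spec R | K `<=` p]].
have H0 : infimums H 0%E.
  split=> [_ [q _ <-]|u]; first exact: prime_height_ge0.
  by rewrite -p0; apply; exists p.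
rewrite /ideal_height -/H /infimum; case: ifPn => [/eqP HE|_].
  by have : H (prime_height p) by [exists p]; rewrite HE.
case: xgetP => [y _ Hy|/(_ 0%E)//].
by rewrite (is_subset1_infimums Hy H0) ltxx.
Qed.

End Height.

(** * Linear maps, dual modules, and functions on formal sums of tensors *)

Section LinearMaps.
Variables (R : comPzRingType) (U V : lmodType R) (f : U -> V) (lin_f : linear f).

Definition linear_map_fun := f.

HB.instance Definition _ := GRing.isLinear.Build R U V *:%R linear_map_fun lin_f.

Definition linear_map : {linear U -> V} := linear_map_fun.

End LinearMaps.

Section Duality.
Variables (R : comPzRingType) (M : lmodType R).
Implicit Types (h k : dual M) (x y : M) (a : R).

Definition mkdual (f : M -> R^o) (lin_f : linear f) : dual M := linear_map lin_f.

Lemma dual_funD h x y : dual_fun h (x + y) = dual_fun h x + dual_fun h y.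
Proof. exact: (linearD (h : {linear M -> R^o})). Qed.

Lemma dual_funZ h a x : dual_fun h (a *: x) = a * dual_fun h x.
Proof. exact: (linearZ_LR (h : {linear M -> R^o})). Qed.

Lemma dual_addE h k x : dual_fun (h + k) x = dual_fun h x + dual_fun k x.
Proof. by []. Qed.

Lemma dual_scaleE a h x : dual_fun (a *: h) x = a * dual_fun h x.
Proof. by []. Qed.

Lemma dual_sumE (T : Type) (s : seq T) (F : T -> dual M) x :
  dual_fun (\sum_(i <- s) F i) x = \sum_(i <- s) dual_fun (F i) x.
Proof.
by elim: s => [|i s IH]; rewrite ?big_nil // !big_cons dual_addE IH.
Qed.

End Duality.

Section TensorMaps.
Variables (R : comPzRingType) (M N : lmodType R).
Implicit Types (x : M) (y : N) (a : R).

Lemma pure_tensorZl a x y : pure_tensor (a *: x) y = a *: pure_tensor x y.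
Proof. by rewrite /pure_tensor [RHS]tensor_scaleE. Qed.

Lemma pure_tensorZr a x y : pure_tensor x (a *: y) = a *: pure_tensor x y.
Proof.
by rewrite -pure_tensorZl; apply/esym/tensor_sumP; apply: TensorZ.
Qed.

Lemma pure_tensorDl x x' y :
  pure_tensor (x + x') y = pure_tensor x y + pure_tensor x' y.
Proof. by rewrite tensor_sumD; apply/tensor_sumP; apply: TensorDl. Qed.

Lemma tensor_sumE (s : seq (M * N)) :
  tensor_sum s = \sum_(xy <- s) pure_tensor xy.1 xy.2.
Proof.
elim: s => [|[x y] s IH]; first by rewrite big_nil.
by rewrite big_cons -IH tensor_sumD.
Qed.

(** [B] is bilinear only modulo [K], so its value on a tensor is defined modulo [K]. With [K] = 0
    this gives evaluation; a larger [K] admits coefficients that are chosen without linearity. *)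
Lemma tensor_rel_mod (B : M -> N -> R) (K : set R) : is_ideal K ->
  (forall x x' y, K (B (x + x') y - (B x y + B x' y))) ->
  (forall x y y', K (B x (y + y') - (B x y + B x y'))) ->
  (forall a x y, K (B (a *: x) y - B x (a *: y))) ->
  forall s t, tensor_rel s t ->
    K (\sum_(xy <- s) B xy.1 xy.2 - \sum_(xy <- t) B xy.1 xy.2).
Proof.
move=> hK BDl BDr BZ s t.
elim=> {s t} [s|s t _|t s u _ + _|s s' t t' _ + _|s t|x x' y|x y y'|a x y|y].
- by rewrite subrr; apply: (ideal0 hK).
- by move=> /(idealN hK); rewrite opprB.
- by move=> Kst Ktu; have := idealD hK Kst Ktu; rewrite addrA subrK.
- by move=> Ks Kt; rewrite !big_cat opprD addrACA; apply: (idealD hK).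
- by rewrite !big_cat /= [X in X - _]addrC subrr; apply: (ideal0 hK).
- by rewrite !big_cons !big_nil /= !addr0; apply: BDl.
- by rewrite !big_cons !big_nil /= !addr0; apply: BDr.
- by rewrite !big_cons !big_nil /= !addr0; apply: BZ.
- have := idealN hK (BDl 0 0 y).
  by rewrite !big_cons !big_nil /= !addr0 subr0 opprB addrK.
Qed.

End TensorMaps.

(** * The dual of an ideal and the evaluation map *)

Section IdealDual.
Variables (R : comPzRingType) (I : ideal R).
Local Notation M := (ideal_mod I).
Local Notation T := (tensor M (dual M)).
Implicit Types (h k : dual M) (x y : M) (a b r : R) (u v : T) (s t : seq (M * dual M)).

Lemma ideal_valI x : ideal_set I (ideal_val x).
Proof. exact/asboolP/(ideal_valP x). Qed.

Definition elt (r : R) (Ir : ideal_set I r) : M := IdealMod (asboolT Ir).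

Lemma ideal_val_elt r (Ir : ideal_set I r) : ideal_val (elt Ir) = r. Proof. by []. Qed.

Lemma ideal_val_inj : injective (@ideal_val R I).
Proof. exact: val_inj. Qed.

Lemma ideal_valD x y : ideal_val (x + y) = ideal_val x + ideal_val y :> R.
Proof. by []. Qed.

Lemma ideal_valZ a x : ideal_val (a *: x) = a * ideal_val x :> R.
Proof. by []. Qed.

Definition incl : dual M := @mkdual R M (@ideal_val R I) (fun a x y => erefl).

Lemma inclE x : dual_fun incl x = ideal_val x. Proof. by []. Qed.

Lemma scale_swap x y : (ideal_val x : R) *: y = (ideal_val y : R) *: x.
Proof. by apply: ideal_val_inj; rewrite !ideal_valZ mulrC. Qed.

(** Both sides are the value of [h] at the product of [x] and [y]. *)
Lemma dual_swap_val h x y :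
  dual_fun h x * ideal_val y = ideal_val x * dual_fun h y :> R.
Proof. by rewrite -dual_funZ scale_swap dual_funZ mulrC. Qed.

Lemma dual_scale_swap h x y : (dual_fun h x : R) *: y = (dual_fun h y : R) *: x.
Proof.
apply: ideal_val_inj; rewrite !ideal_valZ.
by rewrite [LHS]dual_swap_val [RHS]mulrC.
Qed.

Lemma dual_swap h k x y :
  dual_fun h x * dual_fun k y = dual_fun h y * dual_fun k x :> R.
Proof. by rewrite -!dual_funZ dual_scale_swap. Qed.

Definition ev_seq s : R := \sum_(xh <- s) dual_fun xh.2 xh.1.

Lemma ev_seq_rel s t : tensor_rel s t -> ev_seq s = ev_seq t.
Proof.
move=> /(tensor_rel_mod (B := fun x h => dual_fun h x) (is_ideal0 R)) e.
apply/eqP; rewrite -subr_eq0; apply/eqP; apply: e => [x x' h|x h h'|a x h] /=.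
- by rewrite dual_funD subrr.
- by rewrite subrr.
- by rewrite dual_funZ subrr.
Qed.

Definition ev_fun (u : T) : R^o := ev_seq (generic_quotient.repr u).

Lemma ev_funE s : ev_fun (tensor_sum s) = ev_seq s.
Proof. exact/ev_seq_rel/repr_tensor. Qed.

Lemma ev_linear : linear ev_fun.
Proof.
move=> a; elim/tensor_ind=> s; elim/tensor_ind=> t.
rewrite [a *: tensor_sum s]tensor_scaleE tensor_sumD !ev_funE /ev_seq big_cat /=.
rewrite big_map scaler_sumr; congr (_ + _); apply: eq_bigr => -[x h] _ /=.
exact: dual_funZ.
Qed.

Definition ev : dual T := mkdual ev_linear.

Lemma ev_sum s : dual_fun ev (tensor_sum s) = ev_seq s.
Proof. exact: ev_funE. Qed.

Lemma ev_pure x h : dual_fun ev (pure_tensor x h) = dual_fun h x.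
Proof. by rewrite ev_sum /ev_seq big_cons big_nil addr0. Qed.

Lemma pure_swap x h y k :
  (dual_fun h x : R) *: pure_tensor y k = (dual_fun k y : R) *: pure_tensor x h.
Proof.
rewrite -pure_tensorZl dual_scale_swap pure_tensorZl -pure_tensorZr.
rewrite (_ : (dual_fun h y : R) *: k = (dual_fun k y : R) *: h) ?pure_tensorZr //.
by apply: dualP => z; rewrite !dual_scaleE [RHS]mulrC dual_swap mulrC.
Qed.

(** By bilinearity it suffices to exchange pure tensors. Hence a tensor in the kernel of [ev] is
    killed by the whole trace ideal, and a tensor of value 1 generates the tensor product. *)
Lemma ev_swap u v : (dual_fun ev u : R) *: v = (dual_fun ev v : R) *: u.
Proof.
elim/tensor_ind: u => s; elim/tensor_ind: v => t.
rewrite !ev_sum /ev_seq !tensor_sumE !scaler_suml.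
under eq_bigr do rewrite scaler_sumr.
under [RHS]eq_bigr do rewrite scaler_sumr.
rewrite exchange_big /=; apply: eq_bigr => -[y k] _; apply: eq_bigr => -[x h] _.
exact: pure_swap.
Qed.

Lemma ev_image_ideal : @is_ideal R [set r | exists u, dual_fun ev u = r].
Proof.
split=> [|_ _ [u <-] [v <-]|a _ [u <-]].
- by exists 0; have := dual_funZ ev 0 0; rewrite scaler0 mul0r.
- by exists (u + v); rewrite dual_funD.
- by exists (a *: u); rewrite dual_funZ.
Qed.

End IdealDual.

Lemma inj_surj_bijective (A B : Type) (f : A -> B) :
  injective f -> (forall y, exists x, f x = y) -> bijective f.
Proof.
move=> f_inj /choice[g fg]; exists g => // x; exact/f_inj/fg.
Qed.

(** The product of the denominators of finitely many generators of [L] serves for all of [L]. *)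
Lemma uniform_denominator (R : comPzRingType) (p : Spec R) (K L : set R) :
  noetherian R -> is_ideal K -> is_ideal L ->
  (forall l, L l -> exists2 s, ~ spec_set p s & K (s * l)) ->
  exists2 s, ~ spec_set p s & forall l, L l -> K (s * l).
Proof.
move=> noethR hK hL hs; have [t Lt] := noethR L hL.
suff [s ps Ks] : exists2 s, ~ spec_set p s & forall l, l \in t -> K (s * l).
  exists s => // l; rewrite Lt => /(ideal_gen_sub _) tl.
  have := tl (colon K s) (colon_ideal s hK); rewrite /colon /= mulrC; apply.
  by move=> r /= /Ks; rewrite mulrC.
have : forall l, l \in t -> L l by move=> l lt; rewrite Lt; apply: sub_ideal_gen.
elim: t {Lt} => [_|a t IH tL].
  by exists 1 => //; exact: (prime_proper (specP p)).
have [|s ps Ks] := IH; first by move=> l lt; apply: tL; rewrite inE lt orbT.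
have [|u pu Ku] := hs a; first by apply: tL; rewrite mem_head.
exists (s * u); first exact: (primeM (specP p)).
move=> l; rewrite inE => /orP[/eqP ->|/Ks Ksl].
  by rewrite -mulrA; apply: (idealMl _ hK).
by rewrite mulrAC; apply: (idealMr _ hK).
Qed.

(** * Local freeness and the trace ideal *)

Section Invertible.
Variables (R : comPzRingType) (I : ideal R).
Local Notation M := (ideal_mod I).
Local Notation T := (tensor M (dual M)).
Implicit Types (h k : dual M) (x y : M) (a b r : R).

(** Otherwise the trace ideal lies in a prime p. If m generates I at p, division by m, after
    clearing denominators, is a linear form on I whose value at m is outside p; yet this value
    belongs to the trace ideal. *)
Lemma locally_free_ev_surj : noetherian R -> locally_free_rank_one M ->
  exists v : T, dual_fun (ev I) v = 1.
Proof.
move=> noethR lfree; pose J := [set r : R | exists v, dual_fun (ev I) v = r].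
have hJ : is_ideal J := ev_image_ideal I.
apply: contrapT => J1.
have [r0 pp Jp] := colon_prime_above noethR hJ J1.
set p := MkSpec pp; have {}Jp : J `<=` p.
  by apply: subset_trans Jp; exact: sub_colon.
have [f [g fK gK]] := lfree p.
have [m [s0 gE]] : exists (m : M) (s0 : denom p), g 1 = Defs.frac m s0.
  by elim/frac_ind: (g 1) => m s0; exists m, s0.
pose x : R := ideal_val m.
have hx : is_ideal [set x * b | b in [set: R]].
  split=> [|_ _ [b _ <-] [c _ <-]|a _ [b _ <-]].
  - by exists 0 => //; rewrite mulr0.
  - by exists (b + c) => //; rewrite mulrDr.
  - by exists (a * b) => //; rewrite mulrCA.
have gen (y : R) : ideal_set I y ->
    exists2 s, ~ spec_set p s & [set x * b | b in setT] (s * y).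
  move=> Iy; pose z : locmod p M := Defs.frac (elt Iy) (denom1 p).
  have : z = (f z : locring p) *: (Defs.frac m s0 : locmod p M).
    by apply: (can_inj fK); rewrite linearZ_LR -gE gK [RHS]mulr1.
  elim/fr_ind: (f z : locring p) => a t.
  rewrite [_ *: _]loc_scaleE => /fracP[u /(congr1 (@ideal_val R I))].
  rewrite !ideal_valZ ideal_val_elt den1 mulr1 -/x => e.
  exists (den u * den (denomM t s0)); last by rewrite e; exists (den u * a) => //; ring.
  by apply: (primeM (specP p)); exact: denomP.
have ann a : a * x = 0 -> exists2 s, ~ spec_set p s & s * a = 0.
  move=> ax; apply/(fr_eq0 _ (denom1 p)).
  have am : a *: m = 0 by apply: ideal_val_inj; rewrite ideal_valZ ax.
  have z0 : fr a (denom1 p) *: (Defs.frac m s0 : locmod p M) = 0.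
    rewrite [_ *: _]loc_scaleE am; apply/fracP; exists (denom1 p).
    by rewrite !scaler0.
  have := congr1 f z0; rewrite linearZ_LR -gE gK linear0 => <-.
  by rewrite [RHS]mulr1.
have [s ps sI] := uniform_denominator noethR hx (idealP I) gen.
have [|t pt t_ann] := uniform_denominator noethR (is_ideal0 R)
    (colon_ideal x (is_ideal0 R)) (p := p); first exact: ann.
have [q qE] : {q : M -> R & forall y, s * ideal_val y = x * q y}.
  apply: (@choice _ _ (fun y b => s * ideal_val y = x * b)) => y.
  by have [b _ e] := sI _ (ideal_valI y); exists b.
(* [q y] is an arbitrary choice, determined only up to the annihilator of [x]; as [t] kills that
   annihilator, [h] is linear. *)
pose h y : R^o := t * q y.
have lin_h : linear h.
  move=> a y z; rewrite /h; apply/eqP; rewrite -subr_eq0.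
  rewrite (_ : _ - _ = t * (q (a *: y + z) - a * q y - q z)); last first.
    by rewrite -[a *: (t * q y : R^o)]/(a * (t * q y)); ring.
  apply/eqP; apply: t_ann; rewrite /colon /= mulrC !mulrBr.
  by rewrite -qE mulrCA -!qE ideal_valD ideal_valZ; ring.
have : t * (s - q m) = 0.
  by apply: t_ann; rewrite /colon /= mulrBl [s * x]qE mulrC subrr.
move/eqP; rewrite mulrBr subr_eq0 => /eqP ts.
apply: (primeM (specP p) pt ps); rewrite ts; apply: Jp.
by exists (pure_tensor m (mkdual lin_h)); rewrite ev_pure.
Qed.

Variable v : T.
Hypothesis ev1 : dual_fun (ev I) v = 1.

Lemma ev_section : exists s : seq (M * dual M), ev_seq s = 1.
Proof.
by elim/tensor_ind: v ev1 => s; rewrite ev_sum; exists s.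
Qed.

(** Expand [y] as 1 times [y] and exchange x with [y] in each h(x) y: the pairs of [s] form a dual
    basis. *)
Lemma dual_basis (s : seq (M * dual M)) y : ev_seq s = 1 ->
  y = \sum_(xh <- s) (dual_fun xh.2 y : R) *: xh.1.
Proof.
move=> s1; rewrite -[LHS]scale1r -s1 scaler_suml.
by apply: eq_bigr => -[x h] _; exact: dual_scale_swap.
Qed.

Lemma ev_notin_prime (p : Spec R) : exists x h, ~ spec_set p (dual_fun h x).
Proof.
have [s s1] := ev_section; apply: contrapT => np.
apply: (prime_proper (specP p)); rewrite -s1.
apply: (ideal_sum _ (prime_ideal (specP p))) => -[x h] _ /=.
by apply: contrapT => ph; apply: np; exists x, h.
Qed.

Lemma ev_surj_finitely_generated : finitely_generated M.
Proof.
have [s s1] := ev_section; exists (size s), (fun i => (nth (0, 0) s i).1) => y.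
exists (fun i => dual_fun (nth (0, 0) s i).2 y).
rewrite {1}(dual_basis y s1) (big_nth (0, 0)) big_mkord.
by apply: eq_bigr.
Qed.

Lemma ev_surj_projective : is_projective M.
Proof.
move=> U V g f g_surj; have [s s1] := ev_section.
have [w wE] : {w : M -> U & forall x, g (w x) = f x}.
  by apply: (@choice _ _ (fun x u => g u = f x)) => x; exact: g_surj.
pose H y := \sum_(xh <- s) (dual_fun xh.2 y : R) *: w xh.1.
have lin_H : linear H.
  move=> a y z; rewrite /H scaler_sumr -big_split; apply: eq_bigr => -[x h] _ /=.
  by rewrite dual_funD dual_funZ scalerDl scalerA.
exists (linear_map lin_H) => y.
rewrite [in RHS](dual_basis y s1) !raddf_sum /=.
by apply: eq_bigr => -[x h] _; rewrite !linearZ_LR /= wE.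
Qed.

(** Some h(x) is a unit at p, so the map induced by h is an isomorphism with inverse r -> r x /
    h(x). *)
Lemma ev_surj_locally_free : locally_free_rank_one M.
Proof.
move=> p; have [x [h ph]] := ev_notin_prime p.
pose F (z : locmod p M) : (locring p)^o :=
  let: (y, t) := generic_quotient.repr z in @fr R p (dual_fun h y) t.
have FE y t : F (Defs.frac y t) = @fr R p (dual_fun h y) t.
  rewrite /F; have [y' [t' [-> [u e]]]] := repr_frac y t.
  apply/fr_eq; exists (den u); first exact: denomP.
  by have := congr1 (dual_fun h) e; rewrite !dual_funZ.
have lin_F : linear F.
  elim/fr_ind=> a s; elim/frac_ind=> y t; elim/frac_ind=> z w.
  rewrite [_ *: Defs.frac _ _]loc_scaleE fracD !FE dual_funD !dual_funZ.
  have := frD (a * dual_fun h y) (denomM s t) (dual_fun h z) w.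
  by rewrite -frM => <-.
have FL z : linear_map lin_F z = F z by [].
exists (linear_map lin_F); apply: inj_surj_bijective => [z z'|].
  rewrite !FL; elim/frac_ind: z => y t; elim/frac_ind: z' => y' t'.
  rewrite !FE => /fr_eq[u pu e]; apply/fracP.
  exists (denomM (mkden pu) (mkden ph)).
  have swap (r : R) w : (r * dual_fun h w) *: x = (r * dual_fun h x) *: w.
    by rewrite -!scalerA dual_scale_swap.
  have := congr1 (fun r : R => r *: x) e; rewrite /= !swap !denM !den_mkden.
  by rewrite ![u * _ * dual_fun h x]mulrAC.
elim/fr_ind=> r t; exists (Defs.frac (r *: x) (denomM t (mkden ph))).
rewrite FL FE dual_funZ; apply/fr_eq; exists 1.
  exact: (prime_proper (specP p)).
by rewrite denM den_mkden; ring.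
Qed.

(** [v] is a free generator with coordinate [ev], and [ev] is a free generator of the dual. *)
Lemma ev_surj_reflexive : is_reflexive T.
Proof.
have uE u : u = (dual_fun (ev I) u : R) *: v by rewrite ev_swap ev1 scale1r.
exists (fun Phi => (dual_fun Phi (ev I) : R) *: v) => [u|Phi]; first exact/esym/uE.
apply: dualP => phi; rewrite [LHS]dual_funZ.
have phiE : phi = (dual_fun phi v : R) *: ev I.
  by apply: dualP => u; rewrite {1}(uE u) dual_funZ dual_scaleE mulrC.
by rewrite [in RHS]phiE dual_funZ mulrC.
Qed.

End Invertible.

(** * First consequences of reflexivity: torsion freeness and divisoriality *)

Section Reflexive.
Variables (R : comPzRingType) (I : ideal R) (d : R).
Hypotheses (Id : ideal_set I d) (d0 : forall x, d * x = 0 -> x = 0).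
Local Notation M := (ideal_mod I).
Local Notation T := (tensor M (dual M)).
Hypothesis reflT : is_reflexive T.
Implicit Types (u : T) (phi : dual T).

(** Linear forms separate the elements of a reflexive module. For [u] in the kernel of [ev],
    [ev_swap] gives d u = 0, so d phi(u) = 0 and phi(u) = 0 for every form phi. *)
Lemma reflexive_ev_inj u : dual_fun (ev I) u = 0 -> u = 0.
Proof.
move=> u0; apply: (bij_inj reflT); apply: dualP => phi.
rewrite [LHS](_ : _ = dual_fun phi u) // [RHS](_ : _ = dual_fun phi 0) //.
have phi0 : dual_fun phi 0 = 0.
  by rewrite -(scale0r 0) dual_funZ mul0r.
rewrite phi0; apply: d0; rewrite -dual_funZ.
rewrite (_ : d *: u = (dual_fun (ev I) (pure_tensor (elt Id) (incl I)) : R) *: u).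
  by rewrite ev_swap u0 scale0r.
by rewrite ev_pure inclE.
Qed.

(** With w the tensor of [d] and the inclusion, phi -> r phi(w) / d is a linear form on the dual,
    hence evaluation at some u; at phi = [ev] it takes the value [r], since ev(w) = d. *)
Lemma reflexive_ev_image (r : R) :
  (forall phi, exists c, r * dual_fun phi (pure_tensor (elt Id) (incl I)) = d * c) ->
  exists u, dual_fun (ev I) u = r.
Proof.
move=> /choice[C CE].
have d_inj a b : d * a = d * b -> a = b.
  by move=> /eqP; rewrite -subr_eq0 -mulrBr => /eqP/d0/eqP; rewrite subr_eq0 => /eqP.
have lin_C : @linear_for R (dual T) R^o *:%R C.
  move=> a phi psi; apply: d_inj; rewrite -CE dual_addE dual_scaleE.
  by rewrite mulrDr mulrCA !CE -[a *: (C phi : R^o)]/(a * C phi); ring.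
have [g _ gK] := reflT; exists (g (@mkdual _ (dual T) C lin_C)).
have := congr1 (fun Phi => dual_fun Phi (ev I)) (gK (@mkdual _ (dual T) C lin_C)).
rewrite [LHS](_ : _ = dual_fun (ev I) (g (@mkdual _ (dual T) C lin_C))) // => ->.
by apply: d_inj; rewrite [LHS](esym (CE (ev I))) ev_pure inclE mulrC.
Qed.

End Reflexive.

(** * Reflexivity forces the trace ideal to be the whole ring *)

Section ReflexiveSurjective.
Variables (R : comPzRingType) (I : ideal R) (d : R).
Hypotheses (noethR : noetherian R) (icI : integrally_closed (ideal_set I)).
Hypotheses (Id : ideal_set I d) (d0 : forall x, d * x = 0 -> x = 0).
Local Notation M := (ideal_mod I).
Local Notation T := (tensor M (dual M)).
Implicit Types (h k : dual M) (x y : M) (a b r : R).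

Local Notation at_d h := (dual_fun h (elt Id) : R).

Lemma nonzerodivisor_inj a b : d * a = d * b -> a = b.
Proof.
by move=> /eqP; rewrite -subr_eq0 -mulrBr => /eqP/d0/eqP; rewrite subr_eq0 => /eqP.
Qed.

(** As d h(x) = x h(d), a form on I is determined by its value at the nonzerodivisor [d]; thus I^*
    embeds in R. *)
Lemma dual_at_d_inj h k : at_d h = at_d k -> h = k.
Proof.
move=> hk; apply: dualP => x; apply: nonzerodivisor_inj.
by rewrite -[d]/(ideal_val (elt Id) : R) -!dual_swap_val hk.
Qed.

Lemma dual_finite_generators : exists n (g : 'I_n -> dual M),
  forall h, exists a : 'I_n -> R, h = \sum_i a i *: g i.
Proof.
have [n [c [Ac cgen]]] := finite_subgen noethR [set r : R | exists h, at_d h = r].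
have [g gE] : {g : 'I_n -> dual M & forall i, at_d (g i) = c i}.
  by apply: (@choice _ _ (fun (i : 'I_n) h => at_d h = c i)) => i; apply: Ac.
exists n, g => h; have [|a ha] := cgen (at_d h); first by exists h.
exists (fun i => a i); apply: dual_at_d_inj; rewrite [LHS]ha dual_sumE.
by apply: eq_bigr => i _; rewrite dual_scaleE gE.
Qed.

Section AtPrime.
Variable p : Spec R.

Definition local_generators n (g : 'I_n -> dual M) : Prop :=
  exists2 s, ~ spec_set p s &
    forall h, exists a : 'I_n -> R, s *: h = \sum_i a i *: g i.

Lemma local_generators_drop n (g : 'I_n.+1 -> dual M) (c : 'I_n.+1 -> R) i :
  local_generators g -> \sum_j c j *: g j = 0 -> ~ spec_set p (c i) ->
  local_generators (fun j => g (lift i j)).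
Proof.
move=> [s ps sg] c0 pc; exists (c i * s); first exact: (primeM (specP p)).
move=> h; have [a ah] := sg h; exists (fun j => c i * a (lift i j) - a i * c (lift i j)).
rewrite -scalerA ah (_ : _ *: _ = c i *: \sum_j a j *: g j - a i *: \sum_j c j *: g j);
  last by rewrite c0 scaler0 subr0.
rewrite !scaler_sumr -sumrB (bigD1_ord i) //= !scalerA [c i * _]mulrC subrr add0r.
by apply: eq_bigr => j _; rewrite !scalerA scalerBl.
Qed.

Lemma minimal_local_generators : exists n (g : 'I_n -> dual M),
  local_generators g /\
  forall c : 'I_n -> R, \sum_i c i *: g i = 0 -> forall i, spec_set p (c i).
Proof.
have exn : exists n, `[< exists g : 'I_n -> dual M, local_generators g >].
  have [n [g gE]] := dual_finite_generators; exists n; apply/asboolP; exists g.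
  exists 1; first exact: (prime_proper (specP p)).
  by move=> h; rewrite scale1r; apply: gE.
case: (ex_minnP exn) => n /asboolP[g lg] nmin; exists n, g; split=> // c c0 i.
case: n g lg nmin c c0 i => [|n] g lg nmin c c0 i; first by case: i.
apply: contrapT => pc; suff : (n < n)%N by rewrite ltnn.
apply: nmin; apply/asboolP; exists (fun j => g (lift i j)).
exact: local_generators_drop c0 pc.
Qed.

Hypothesis reflT : is_reflexive T.

Lemma local_generators0 (g : 'I_0 -> dual M) : ~ local_generators g.
Proof.
case=> s ps /(_ (incl I))[a]; rewrite big_ord0 => /(congr1 (fun h => at_d h)) e.
apply: ps; have : d * s = 0 by rewrite mulrC -[RHS]e.
by move/d0 => ->; apply: (ideal0 (prime_ideal (specP p))).
Qed.

(* If I^* is locally generated by g, then the reflexive module I (x) I^* is locally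
   I itself, so I is locally I^** and hence locally free. *)
Lemma local_generators1 (g : 'I_1 -> dual M) : local_generators g ->
  exists2 r, ~ spec_set p r & exists u : T, dual_fun (ev I) u = r.
Proof.
case=> s ps sg; exists (s * s); first exact: (primeM (specP p)).
apply: (reflexive_ev_image d0 reflT (Id := Id)) => phi.
pose g0 := g ord0.
have sg0 h : exists a, s *: h = a *: g0.
  by have [a ->] := sg h; exists (a ord0); rewrite big_ord1.
pose f x : R^o := dual_fun phi (pure_tensor x g0).
have lin_f : linear f.
  by move=> a x y; rewrite /f pure_tensorDl pure_tensorZl dual_funD dual_funZ.
have [a /(congr1 (fun h => at_d h)) fa] := sg0 (mkdual lin_f).
(* With w the tensor of [d] and the inclusion, s s phi(w) = s c f(d) = c a g0(d) = a s d, whence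
   this witness. *)
have [c ci] := sg0 (incl I); exists (a * s).
have /(congr1 (dual_fun phi)) := congr1 (pure_tensor (elt Id)) ci.
rewrite !pure_tensorZr !dual_funZ => e1.
have := congr1 (fun h => at_d h) ci; rewrite !dual_scaleE inclE ideal_val_elt => e2.
move: fa; rewrite !dual_scaleE -[dual_fun (mkdual lin_f) _]/(f (elt Id)) /f => e3.
rewrite -mulrA e1 mulrCA e3 mulrCA -e2; ring.
Qed.

Section Relations.
Variables (n : nat) (g : 'I_n -> dual M) (s : R).
Hypothesis sg : forall h, exists a : 'I_n -> R, s *: h = \sum_i a i *: g i.

Definition relation_coefs : set R :=
  ideal_gen [set r | exists c : 'I_n -> R,
    \sum_i c i *: g i = 0 /\ exists i, r = c i].

Lemma mem_relation_coefs (c : 'I_n -> R) i :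
  \sum_j c j *: g j = 0 -> relation_coefs (c i).
Proof. by move=> c0; apply: sub_ideal_gen; exists c; split=> //; exists i. Qed.

(* The map x (x) h |-> (x times the coefficients of s h on g) is well defined
   modulo I L where L is the ideal of the coefficients of the relations. Applied
   to the vanishing tensor \sum_j u c_j (x) g_j it yields s u c_i in I L. *)
Lemma relation_coefs_mul u : (forall r, spec_set p r -> ideal_set I (r * u)) ->
  (forall c : 'I_n -> R, \sum_i c i *: g i = 0 -> forall i, spec_set p (c i)) ->
  forall l, relation_coefs l ->
    ideal_mul (ideal_set I) relation_coefs (s * u * l).
Proof.
move=> Iu cp l Ll; set K := ideal_mul _ _; have hK : is_ideal K by exact: ideal_gen_ideal.
suff : colon K (s * u) l by rewrite /colon /= mulrC.
move: l Ll; apply: ideal_gen_sub; first exact: colon_ideal.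
move=> _ [c [c0 [i0 ->]]]; rewrite /colon /=.
have [al alE] := choice sg.
have Lal (b : 'I_n -> R) i : \sum_j b j *: g j = 0 -> relation_coefs (b i).
  exact: mem_relation_coefs.
pose B x h : R := ideal_val x * al h i0.
have K0 : K 0 by exact: (ideal0 hK).
have BP s1 s2 := @tensor_rel_mod _ _ _ B K hK _ _ _ s1 s2.
pose y j : M := elt (Iu _ (cp c c0 j)).
pose t := [seq (y j, g j) | j <- enum 'I_n].
have t0 : tensor_rel t [::].
  apply/tensor_sumP; apply: (reflexive_ev_inj Id d0 reflT).
  rewrite ev_sum /ev_seq big_map big_enum /=; apply: nonzerodivisor_inj.
  rewrite mulr0 mulr_sumr (eq_bigr (fun j => u * (c j * at_d (g j)))).
    have := congr1 (fun h => at_d h) c0; rewrite dual_sumE /= => e.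
    by rewrite -mulr_sumr [X in u * X]e mulr0.
  move=> j _; transitivity (at_d (g j) * ideal_val (y j)).
    exact/esym/dual_swap_val.
  by rewrite ideal_val_elt; ring.
have : K (\sum_(xh <- t) B xh.1 xh.2 - \sum_(xh <- [::]) B xh.1 xh.2).
  apply: BP t0 => [x x' h|x h k|a x h].
  - by rewrite /B ideal_valD mulrDl subrr.
  - rewrite /B -mulrDr -mulrBr; apply: mem_ideal_mul; first exact: ideal_valI.
    apply: (Lal (fun j => al (h + k) j - (al h j + al k j))).
    rewrite (eq_bigr (fun j => al (h + k) j *: g j - (al h j *: g j + al k j *: g j))).
      by rewrite sumrB big_split -!alE scalerDr subrr.
    by move=> j _; rewrite scalerBl scalerDl.
  - rewrite /B ideal_valZ -mulrA mulrCA -mulrBr; apply: mem_ideal_mul.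
      exact: ideal_valI.
    apply: (Lal (fun j => a * al h j - al (a *: h) j)).
    rewrite (eq_bigr (fun j => a *: (al h j *: g j) - al (a *: h) j *: g j)).
      by rewrite sumrB -scaler_sumr -!alE !scalerA mulrC subrr.
    by move=> j _; rewrite scalerBl scalerA.
rewrite big_nil subr0 big_map big_enum /= => Kt.
rewrite -[_ * _](subrK (\sum_j B (y j) (g j))); apply: (idealD hK) => //.
(* As s g_j is the combination of the g_m with coefficients [al (g j) m], these differ from s times
   the j-th unit vector by a relation; so modulo [K] one may replace [al (g j) i0] by s if j = i0
   and by 0 otherwise. *)
rewrite (_ : c i0 * (s * u) = \sum_j ideal_val (y j) * (s * (j == i0)%:R)); last first.
  rewrite (bigD1 i0) //= eqxx mulr1 big1 ?addr0; first by ring.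
  by move=> j /negPf ->; rewrite !mulr0.
rewrite -sumrB; apply: (ideal_sum _ hK) => j _; rewrite /B -mulrBr.
apply: mem_ideal_mul; first exact: ideal_valI.
rewrite [j == i0]eq_sym; apply: (Lal (fun m => s * (m == j)%:R - al (g j) m)).
rewrite (eq_bigr (fun m => (s * (m == j)%:R) *: g m - al (g j) m *: g m)).
  rewrite sumrB -alE (bigD1 j) //= eqxx mulr1 big1 ?addr0 ?subrr //.
  by move=> m /negPf ->; rewrite mulr0 scale0r.
by move=> m _; rewrite scalerBl.
Qed.

(** Any two generators satisfy g_i(d) g_j = g_j(d) g_i, so a second index [j] makes g_i(d) a
    coefficient of a relation. *)
Lemma at_d_relation_coefs i j : i != j -> relation_coefs (at_d (g i)).
Proof.
move=> ij; pose c m := at_d (g i) * (m == j)%:R - at_d (g j) * (m == i)%:R.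
have -> : at_d (g i) = c j by rewrite /c eqxx eq_sym (negPf ij) mulr1 mulr0 subr0.
apply: mem_relation_coefs.
rewrite (eq_bigr (fun m => (at_d (g i) * (m == j)%:R) *: g m -
  (at_d (g j) * (m == i)%:R) *: g m)); last by move=> m _; rewrite scalerBl.
have delta a (l : 'I_n) : \sum_m (a * (m == l)%:R) *: g m = a *: g l.
  rewrite (bigD1 l) //= eqxx mulr1 big1 ?addr0 // => m /negPf ->.
  by rewrite mulr0 scale0r.
rewrite sumrB !delta; apply/eqP; rewrite subr_eq0; apply/eqP/dual_at_d_inj.
by rewrite !dual_scaleE mulrC.
Qed.

End Relations.

(** The determinant trick is applied to s u and the ideal L of relation coefficients. An element y
    that kills L kills all g_i(d), hence s d, so s y = 0. Thus s s u lies in I, and s s in [p] = (I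
    : u), a contradiction. *)
Lemma local_generators_ge2 n (g : 'I_n.+2 -> dual M) u : local_generators g ->
  (forall c : 'I_n.+2 -> R, \sum_i c i *: g i = 0 -> forall i, spec_set p (c i)) ->
  spec_set p <> colon (ideal_set I) u.
Proof.
move=> [s ps sg] cp pu.
have Iu r : spec_set p r -> ideal_set I (r * u) by rewrite pu.
suff : spec_set p (s * s) by apply: (primeM (specP p)).
rewrite pu /colon /= -mulrA.
apply: (determinant_trick noethR (idealP I) icI (ideal_gen_ideal _)).
  exact: (relation_coefs_mul sg Iu cp).
move=> y yL; have [a sa] := sg (incl I); apply: d0.
have : y * (s * d) = 0.
  rewrite (_ : s * d = at_d (s *: incl I)) // sa dual_sumE mulr_sumr big1 // => i _.
  rewrite dual_scaleE mulrCA yL ?mulr0 //.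
  apply: (@at_d_relation_coefs _ _ i (if i == ord0 then ord_max else ord0)).
  by case: ifP => [/eqP ->|/negbT].
by move=> <-; ring.
Qed.

End AtPrime.

(** An associated prime (I : u) of R/I lies below [p], and below it an associated prime of 0, which
    omits [d]. If (I : u) were smaller than [p], these three primes would form a chain of length
    2. *)
Lemma minimal_prime_colon (p : Spec R) : ideal_set I `<=` p ->
  (forall (c : nat -> Spec R) n, prime_chain c n -> c n = p -> (n <= 1)%N) ->
  exists u, spec_set p = colon (ideal_set I) u.
Proof.
move=> Ip chain_le1.
have [u up uSp] := colon_prime_under noethR (idealP I) (specP p) Ip.
have Iu : ideal_set I `<=` colon (ideal_set I) u := sub_colon u (idealP I).
exists u; apply: contrapT => pu.
have [|z zp zSu] := colon_prime_under noethR (is_ideal0 R) up.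
  by move=> _ ->; apply: (ideal0 (prime_ideal up)).
pose c i := match i with 0 => MkSpec zp | 1 => MkSpec up | _ => p end%N.
suff /chain_le1 /(_ erefl) : prime_chain c 2 by [].
case=> [|[|//]] _ /=; split=> //= h.
  have : colon [set 0] z d by apply: h; apply: Iu.
  by rewrite /colon /= => /d0 z0; apply: (prime_proper zp); rewrite z0 /colon /= mulr0.
by apply: pu; apply/seteqP; split.
Qed.

Lemma reflexive_ev_surj : serre_condition R 2 -> is_reflexive T ->
  exists v : T, dual_fun (ev I) v = 1.
Proof.
move=> S2 reflT; apply: contrapT => ev1.
have : ~ forall phi, exists c,
    1 * dual_fun phi (pure_tensor (elt Id) (incl I)) = d * c.
  by move/(reflexive_ev_image d0 reflT).
move=> /existsNP[phi]; rewrite mul1r; set w := dual_fun phi _ => dw.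
pose D := [set d * x | x in [set: R]].
have hD : is_ideal D.
  split=> [|_ _ [b _ <-] [c _ <-]|a _ [b _ <-]].
  - by exists 0 => //; rewrite mulr0.
  - by exists (b + c) => //; rewrite mulrDr.
  - by exists (a * b) => //; rewrite mulrCA.
have [|r pp wp] := @colon_prime_above _ noethR D w hD.
  by case=> b _ e; apply: dw; exists b.
pose p := MkSpec pp.
(* As [d] is the value of the tensor of [d] and the inclusion, [ev_swap] gives ev(u) w = phi(d u) =
   d phi(u); so the trace ideal lies in (dR : w). *)
have ev_p (u : T) : spec_set p (dual_fun (ev I) u).
  apply: wp; exists (dual_fun phi u) => //.
  by rewrite -[RHS]dual_funZ ev_swap dual_funZ ev_pure.
have Ip : ideal_set I `<=` p.
  move=> a Ia; have := ev_p (pure_tensor (elt Ia) (incl I)).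
  by rewrite ev_pure.
have [u pu] := minimal_prime_colon Ip
  (fun c n => serre2_colon_height S2 d0 (erefl : spec_set p = colon D (r * w))).
have [n [g [lg cp]]] := minimal_local_generators p.
case: n g lg cp => [|[|n]] g lg cp.
- exact: local_generators0 lg.
- have [a pa [v va]] := local_generators1 reflT lg.
  by apply: pa; rewrite -va; apply: ev_p.
- exact: (local_generators_ge2 reflT lg cp pu).
Qed.

End ReflexiveSurjective.

(** * Symbolic powers and the primary decomposition of an invertible ideal *)

Section PrimaryDecomposition.
Variables (R : comPzRingType).
Implicit Types (p q : Spec R) (a b r u : R).

Lemma symbolic_power_primary p n : (0 < n)%N ->
  is_primary (symbolic_power p n) /\ radical (symbolic_power p n) = p.
Proof.
case: n => // n _; have pp := specP p; have hp := prime_ideal pp.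
have hK := ideal_pow_ideal p n.+1.
have sub r : symbolic_power p n.+1 r -> spec_set p r.
  move=> /symbolic_powerP[s ps /(ideal_pow_sub hp)].
  by case: pp => _ _ pM /pM[].
have rad : radical (symbolic_power p n.+1) = p.
  apply/seteqP; split=> r; first by case=> k /sub; apply: primeX.
  move=> pr; exists n.+1; apply/symbolic_powerP; exists 1; first exact: prime_proper.
  by rewrite mul1r; apply: ideal_powX.
split=> //; split.
- split=> [|x y|a x].
  + apply/symbolic_powerP; exists 1; first exact: prime_proper.
    by rewrite mulr0; apply: (ideal0 hK).
  + move=> /symbolic_powerP[s ps sx] /symbolic_powerP[t pt ty].
    apply/symbolic_powerP; exists (s * t); first exact: (primeM pp).
    rewrite mulrDr; apply: (idealD hK).
      by rewrite mulrAC; apply: (idealMr _ hK).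
    by rewrite -mulrA; apply: (idealMl _ hK).
  + move=> /symbolic_powerP[s ps sx]; apply/symbolic_powerP; exists s => //.
    by rewrite mulrCA; apply: (idealMl _ hK).
- by move/sub; apply: prime_proper.
- move=> x y /symbolic_powerP[s ps sxy]; rewrite rad.
  have [py|py] := pselect (spec_set p y); [by right|left].
  apply/symbolic_powerP; exists (s * y); first exact: (primeM pp).
  by rewrite mulrAC -mulrA.
Qed.

Lemma ass_quotP (I : ideal R) p : Ass (quot_mod I) p ->
  exists u, spec_set p = colon (ideal_set I) u.
Proof.
case; elim/quot_ind=> u pu; exists u; apply/seteqP.
have e r : r *: quot_proj I u = 0 <-> ideal_set I (r * u).
  rewrite [_ *: _]quot_scaleE; split.
    by move=> /quot_projP; rewrite subr0 => /asboolP.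
  by move=> Iru; apply/quot_projP; rewrite subr0; apply/asboolP.
by split=> r; rewrite pu e.
Qed.

Lemma colon_ass (I : ideal R) u (pp : is_prime_ideal (colon (ideal_set I) u)) :
  Ass (quot_mod I) (MkSpec pp).
Proof.
exists (quot_proj I u) => r; rewrite [_ *: _]quot_scaleE; split.
  by move=> Iru; apply/quot_projP; rewrite subr0; apply/asboolP.
by move=> /quot_projP; rewrite subr0 => /asboolP.
Qed.

Variable I : ideal R.
Hypotheses (noethR : noetherian R) (icI : integrally_closed (ideal_set I)).
Local Notation M := (ideal_mod I).
Variable v : tensor M (dual M).
Hypothesis ev1 : dual_fun (ev I) v = 1.

(* With I_p = x R_p, the colon ideal p = (I : u) is generated at p by x / u: the
   determinant trick excludes (u / x) p_p <= p_p, as u is not integral over I. *)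
Lemma ass_uniformizer p x (h : dual M) : Ass (quot_mod I) p ->
  ~ spec_set p (dual_fun h x) -> exists t w, [/\ spec_set p t, ~ spec_set p w &
    forall r, spec_set p r -> exists b, w * r = t * b].
Proof.
move=> /ass_quotP[u pu] ph; set e : R := dual_fun h x in ph.
have Iu r : spec_set p r -> ideal_set I (r * u) by rewrite pu.
suff [t [pt pht]] : exists t (pt : spec_set p t), ~ spec_set p (dual_fun h (elt (Iu t pt))).
  exists t, (dual_fun h (elt (Iu t pt))); split=> // r pr.
  exists (dual_fun h (elt (Iu r pr))).
  rewrite mulrC -!dual_funZ; congr (dual_fun h _); apply: ideal_val_inj.
  by rewrite !ideal_valZ !ideal_val_elt; ring.
apply: contrapT => nt; apply: (primeM (specP p) ph ph).
rewrite pu /colon /= -mulrA.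
have hp := prime_ideal (specP p).
(* The trick is used with the ideal [p], the element e u and the multiplier e; its conclusion puts e
   e in (I : u) = [p]. An annihilator y of [p] kills [x], so e y = h(y x) = 0. *)
apply: (determinant_trick noethR (idealP I) icI hp) => [l pl|y yp].
  rewrite -mulrA [u * l]mulrC (_ : e * (l * u) =
      ideal_val x * dual_fun h (elt (Iu l pl))); last by rewrite -dual_swap_val.
  apply: mem_ideal_mul; first exact: ideal_valI.
  by apply: contrapT => pht; apply: nt; exists l, pl.
have px : spec_set p (ideal_val x).
  by rewrite pu; apply: (sub_colon u (idealP I)); apply: ideal_valI.
rewrite mulrC -dual_funZ (_ : y *: x = 0).
  by have := dual_funZ h 0 0; rewrite scaler0 mul0r.
by apply: ideal_val_inj; rewrite ideal_valZ yp.
Qed.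

(** At [p] the generator x of I is divided by the uniformizer t as long as the cofactor lies in [p];
    the Noetherian property stops this at x = c t^n with c a unit at [p]. *)
Lemma ass_local_structure p : Ass (quot_mod I) p -> exists t w c n,
  [/\ [/\ spec_set p t, ~ spec_set p w & ~ spec_set p c],
      forall r, spec_set p r -> exists b, w * r = t * b,
      (0 < n)%N, ideal_set I (c * t ^+ n) &
      forall r, ideal_set I r -> exists2 s, ~ spec_set p s & exists b, s * r = b * t ^+ n].
Proof.
move=> Ap; have pp := specP p; have hp := prime_ideal pp.
have [x [h ph]] := ev_notin_prime ev1 p.
have [t [w [pt pw tw]]] := ass_uniformizer Ap ph.
have Ip : ideal_set I `<=` p.
  by have [u ->] := ass_quotP Ap; apply: sub_colon; apply: idealP.
(* [sat c] is the contraction of c R_p. *)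
pose sat c : set R := [set r | exists s b, ~ spec_set p s /\ s * r = c * b].
have sat_ideal c : is_ideal (sat c).
  split=> [|y z [s [b [ps e]]] [s' [b' [ps' e']]]|a y [s [b [ps e]]]].
  - by exists 1, 0; rewrite !mulr0; split=> //; apply: prime_proper.
  - exists (s * s'), (s' * b + s * b'); split; first exact: (primeM pp).
    rewrite mulrDr mulrDr mulrAC e mulrCA -[s * s' * z]mulrA e'; ring.
  - by exists s, (a * b); split=> //; rewrite mulrCA e mulrCA.
pose X : R := ideal_val x.
have [||_ [c [n [s [ps sx]]] <-] cmax] := noetherian_max noethR (F :=
  [set sat c | c in [set c | exists n s, ~ spec_set p s /\ s * X = c * t ^+ n]]).
- by move=> _ [c _ <-].
- exists (sat X), X => //; exists 0%N, 1; rewrite mul1r mulr1; split=> //.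
  exact: prime_proper.
have pc : ~ spec_set p c.
  move=> pc; have [b wc] := tw c pc.
  have sat_cb : sat c `<=` sat b.
    move=> r [s' [a [ps' e]]]; exists (w * s'), (t * a); split; first exact: (primeM pp).
    by rewrite -mulrA e mulrA wc; ring.
  have [a1 [b1 [pa1 e1]]] : sat c b.
    rewrite -(cmax (sat b)) //; last first.
      exists b => //; exists n.+1, (w * s); split; first exact: (primeM pp).
      by rewrite -mulrA sx mulrA wc exprS; ring.
    by exists 1, 1; rewrite mulrC; split=> //; apply: prime_proper.
  (* By maximality b is a multiple of c at [p], so c is killed by [z], which is outside [p] because
     t is in [p]. Then [z * s] kills x, hence also h(x), which is outside [p]. *)
  pose z := a1 * w - t * b1.
  have cz : c * z = 0.
    rewrite /z (_ : c * _ = a1 * (w * c) - t * (c * b1)); last by ring.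
    by rewrite wc -e1; ring.
  have pz : ~ spec_set p z.
    move=> pz; apply: (primeM pp pa1 pw); rewrite -[_ * _](subrK (t * b1)).
    by apply: (idealD hp) => //; apply: (idealMr _ hp).
  have zsx : (z * s) *: x = 0.
    apply: ideal_val_inj; rewrite ideal_valZ -/X -mulrA sx mulrCA mulrA.
    by rewrite cz mul0r.
  apply: (primeM pp (primeM pp pz ps) ph).
  rewrite -dual_funZ zsx (_ : dual_fun h 0 = 0); first exact: (ideal0 hp).
  by have := dual_funZ h 0 0; rewrite scaler0 mul0r.
have IX : ideal_set I X := ideal_valI x.
exists t, w, c, n; split=> //.
(* For n = 0 the cofactor c = s x would lie in I, hence in [p]. *)
- case: n {cmax} sx => // /eqP; rewrite mulr1 => /eqP sx.
  by case: pc; rewrite -sx; apply: (idealMl _ hp); apply: Ip.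
- by rewrite -sx; apply: (idealMl _ (idealP I)).
- move=> r Ir; exists (s * dual_fun h x); first exact: (primeM pp).
  exists (c * dual_fun h (elt Ir)); rewrite -mulrA.
  rewrite (_ : dual_fun h x * r = X * dual_fun h (elt Ir));
    last exact: (dual_swap_val h x (elt Ir)).
  by rewrite mulrA sx mulrAC.
Qed.

(** At [p] both I and the n-th power of [p] are generated by t^n, so they have the same
    contraction. *)
Lemma ass_symbolic_power p : Ass (quot_mod I) p -> exists n, (0 < n)%N /\
  forall r, symbolic_power p n r <-> exists2 s, ~ spec_set p s & ideal_set I (s * r).
Proof.
move=> Ap; have pp := specP p.
have [t [w [c [n [[pt pw pc] tw n0 Ict It]]]]] := ass_local_structure Ap.
exists n; split=> // r; split.
  have pow m y : ideal_pow p m y -> exists b, w ^+ m * y = t ^+ m * b.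
    elim: m y => [y _|m IH]; first by exists y; rewrite !expr0.
    apply: (ideal_gen_sub (K := [set y | exists b, w ^+ m.+1 * y = t ^+ m.+1 * b])).
      split=> [|y z [b yb] [b' zb]|a y [b yb]].
      - by exists 0; rewrite !mulr0.
      - by exists (b + b'); rewrite !mulrDr yb zb.
      - by exists (a * b); rewrite mulrCA yb mulrCA.
    move=> _ [y [z [/tw[b yb] /IH[b' zb] ->]]]; exists (b * b').
    by rewrite !exprS mulrACA yb zb mulrACA.
  move=> /symbolic_powerP[s ps /pow[b e]].
  exists (c * (w ^+ n * s)).
    apply: (primeM pp pc); apply: (primeM pp) => //; by move/(primeX pp).
  by rewrite -!mulrA e mulrA; apply: (idealMr _ (idealP I)).
case=> s ps /It[s' ps' [b e]]; apply/symbolic_powerP; exists (s' * s).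
  exact: (primeM pp).
by rewrite -mulrA e; apply: (idealMl _ (ideal_pow_ideal _ _)); apply: ideal_powX.
Qed.

(** From c t^n in I and c outside [q] it follows that t is in [p]; and t generates [q] locally at
    [q]. Thus R/I has no embedded primes. *)
Lemma ass_incomparable p q : Ass (quot_mod I) p -> Ass (quot_mod I) q ->
  p `<=` q -> p = q.
Proof.
move=> Ap Aq pq; apply: Spec_ext; apply/seteqP; split=> // r qr.
have [t [w [c [n [[qt qw qc] tw n0 Ict _]]]]] := ass_local_structure Aq.
have pp := specP p; have [_ _ pM] := pp.
have pt : spec_set p t.
  have /pM[/pq/qc//|] : spec_set p (c * t ^+ n); last exact: primeX.
  by have [u ->] := ass_quotP Ap; apply: (sub_colon u (idealP I)).
have [b wr] := tw r qr.
have /pM[/pq/qw|] // : spec_set p (w * r).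
by rewrite wr; apply: (idealMr _ (prime_ideal pp)).
Qed.

Lemma ass_finite : finite_set (Ass (quot_mod I)).
Proof.
have [||n [c [Pc cP]]] := incomparable_colon_finite noethR
  (P := [set spec_set p | p in Ass (quot_mod I)]) (idealP I).
- by move=> _ [p /ass_quotP pu <-]; split=> //; apply: specP.
- by move=> _ _ [p Ap <-] [q Aq <-] /(ass_incomparable Ap Aq) ->.
have [->|/set0P[p0 Ap0]] := eqVneq (Ass (quot_mod I)) set0.
  exact: finite_set0.
have [f fE] : {f : nat -> Spec R & forall i, (i < n)%N -> spec_set (f i) = c i}.
  apply: (@choice _ _ (fun i q => (i < n)%N -> spec_set q = c i)) => i.
  have [lin|] := ltnP i n; last by exists p0.
  by have [p _ pc] := Pc i lin; exists p.
apply: (@sub_finite_set _ _ (f @` `I_n)); last exact/finite_image/finite_II.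
move=> p Ap; have [|i lin pc] := cP p; first by exists p.
by exists i => //; apply: Spec_ext; rewrite fE.
Qed.

Lemma ass_primary_decomposition : exists n : Spec R -> nat,
  (forall p, Ass (quot_mod I) p -> (0 < n p)%N) /\
  primary_decomposition (ideal_set I) (Ass (quot_mod I))
    (fun p => symbolic_power p (n p)).
Proof.
have [n nP] : {n : Spec R -> nat & forall p, Ass (quot_mod I) p -> (0 < n p)%N /\
    forall r, symbolic_power p (n p) r <->
      exists2 s, ~ spec_set p s & ideal_set I (s * r)}.
  apply: (@choice _ _ (fun p m => Ass (quot_mod I) p -> (0 < m)%N /\ forall r,
    symbolic_power p m r <-> exists2 s, ~ spec_set p s & ideal_set I (s * r))) => p.
  have [Ap|nAp] := pselect (Ass (quot_mod I) p); last by exists 0%N.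
  by have [m mP] := ass_symbolic_power Ap; exists m.
exists n; split; first by move=> p /nP[].
split; first exact: ass_finite.
  by move=> p /nP[n0 _]; apply: symbolic_power_primary.
apply/seteqP; split=> r Ir.
  move=> p Ap; apply/(proj2 (nP p Ap)); exists 1; first exact: (prime_proper (specP p)).
  by rewrite mul1r.
(* For [r] outside I some associated prime p contains (I : r), whereas [r] being in I_p means that
   (I : r) meets the complement of p. *)
apply: contrapT => nIr.
have [a pp rp] := colon_prime_above noethR (idealP I) nIr.
have Ap := colon_ass pp.
have /(proj2 (nP _ Ap))[s ps Isr] := Ir _ Ap.
exact/ps/rp.
Qed.

End PrimaryDecomposition.

(** By (S_2) every associated prime of 0 has height 0, while a prime above I has positive height; so
    I lies in no associated prime of 0 and [exists_nonzerodivisor] applies. *)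
Lemma serre2_nonzerodivisor (R : comPzRingType) (I : ideal R) :
  noetherian R -> serre_condition R 2 -> (0%E < ideal_height (ideal_set I))%E ->
  exists2 d, ideal_set I d & forall x, d * x = 0 -> x = 0.
Proof.
move=> noethR S2R htI.
apply: (exists_nonzerodivisor noethR (idealP I)) => x xp Ix.
have [c [n [ch cn]]] := ideal_height_gt0 (p := MkSpec xp) htI Ix.
by rewrite (serre2_ann_height (p := MkSpec xp) S2R erefl ch cn).
Qed.

Theorem theorem1p4 (R : comPzRingType) (I : ideal R)
    (noethR : noetherian R) (S2R : serre_condition R 2)
    (icI : integrally_closed (ideal_set I))
    (htI : (0%E < ideal_height (ideal_set I))%E) :
  [/\ (locally_free_rank_one (ideal_mod I) <->
       is_reflexive (tensor (ideal_mod I) (dual (ideal_mod I)))),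
      (locally_free_rank_one (ideal_mod I) ->
       represents_Pic_class (ideal_mod I))
    & (locally_free_rank_one (ideal_mod I) \/
       is_reflexive (tensor (ideal_mod I) (dual (ideal_mod I))) ->
       exists n : Spec R -> nat,
         (forall p, Ass (quot_mod I) p -> (0 < n p)%N) /\
         primary_decomposition (ideal_set I) (Ass (quot_mod I))
           (fun p => symbolic_power p (n p)))].
Proof.
have [d Id d0] := serre2_nonzerodivisor noethR S2R htI.
(* Both conditions are compared with a third one: [ev] takes the value 1. *)
have free_ev := locally_free_ev_surj (I := I) noethR.
have refl_ev := reflexive_ev_surj noethR icI Id d0 S2R.
split.
- by split=> [/free_ev|/refl_ev] [v ev1];
    [exact: ev_surj_reflexive ev1|exact: ev_surj_locally_free ev1].
- move=> lfree; have [v ev1] := free_ev lfree; split=> //.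
    exact: ev_surj_finitely_generated ev1.
  exact: ev_surj_projective ev1.
- by move=> [/free_ev|/refl_ev] [v ev1]; exact: ass_primary_decomposition ev1.
Qed.
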